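(* Let $p:\mathbb{R}^n\to\mathbb{R}$ be a homogeneous polynomial of degree $d$ hyperbolic along $e$, and suppose that $\Lambda_+(p,e)$ is a regular hyperbolicity cone that is rank-one generated (ROG) with respect to $p$. Then $\Lambda_+^{(k)}(p,e)$ is not homogeneous for $1\le k\le d-3$.
   Context: A homogeneous polynomial $p:\mathbb{R}^n\to\mathbb{R}$ of degree $d$ is hyperbolic along $e\in\mathbb{R}^n$ if $p(e)>0$ and for every $x\in\mathbb{R}^n$ the univariate polynomial $t\mapsto p(x-te)$ has only real roots. Its hyperbolicity cone is the closed convex cone $\Lambda_+(p,e)=\{x\in\mathbb{R}^n\mid \text{all roots of } t\mapsto p(te-x) \text{ are nonnegative}\}$. For $x\in\Lambda_+(p,e)$, $\operatorname{rank}(x)$ is the number of nonzero roots, counted with multiplicity, of $t\mapsto p(te-x)$. With $D_e^kp(x)=\frac{d^k}{dt^k}p(x+te)|_{t=0}$ (again hyperbolic along $e$), the $k$-th derivative relaxation is $\Lambda_+^{(k)}(p,e)=\Lambda_+(D_e^kp,e)$. A closed convex cone $K\subseteq\mathbb{R}^n$ is pointed if $K\cap(-K)=\{0\}$, and regular if it is pointed and $\dim K=n$. A face of $K$ is a nonempty convex cone $F\subseteq K$ such that $x,y\in K$, $x+y\in F$ imply $x,y\in F$; an extreme ray is a face of dimension $1$. A pointed hyperbolicity cone $\Lambda_+(p,e)$ is ROG with respect to $p$ (and $e$) if each of its extreme rays is generated by an element of rank $1$. $\operatorname{Aut}(K)=\{A\in \mathrm{GL}_n(\mathbb{R})\mid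 AK=K\}$. A closed convex cone $K$ is homogeneous if for any $x,y$ in the relative interior of $K$ there exists $A\in\operatorname{Aut}(K)$ with $Ax=y$. *)

(* Defs.v *)
From mathcomp Require Import all_boot all_order all_algebra.
From mathcomp Require Import complex polyrcf.
From mathcomp Require Import classical_sets reals topology.
(* The notations of mpoly clash with those of normedtype, so only its
   canonical structures and constants are imported; [mpoly n R] is the type
   that mpoly denotes by {mpoly R[n]}. *)
From mathcomp Require Import -(notations) mpoly.

Set Implicit Arguments.
Unset Strict Implicit.
Unset Printing Implicit Defensive.

Import Order.TTheory GRing.Theory Num.Theory numFieldTopology.Exports.
Local Open Scope classical_set_scope.
Local Open Scope ring_scope.

Definition mhomogeneous (R : realType) (n d : nat) (p : mpoly n R) : bool :=
  p \is ishomog1 d mdeg.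

Definition peval (R : realType) (n : nat) (p : mpoly n R) (x : 'cV[R]_n) : R :=
  meval (fun i => x i 0) p.

(* The univariate polynomial t |-> p(x + t v). *)
Definition line_poly (R : realType) (n : nat) (p : mpoly n R)
    (x v : 'cV[R]_n) : {poly R} :=
  mmap (@polyC R) (fun i => (x i 0)%:P + v i 0 *: 'X) p.

Lemma line_polyE (R : realType) (n : nat) (p : mpoly n R)
    (x v : 'cV[R]_n) (t : R) :
  (line_poly p x v).[t] = peval p (x + t *: v).
Proof.
rewrite /line_poly /peval /meval /mmap horner_sum; apply: eq_bigr => m _.
rewrite hornerM hornerC /mmap1 horner_prod; congr (_ * _).
apply: eq_bigr => i _.
by rewrite horner_exp hornerD hornerC hornerZ hornerX !mxE mulrC.
Qed.

Definition hyperbolic (R : realType) (n d : nat) (p : mpoly n R)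
    (e : 'cV[R]_n) : Prop :=
  [/\ mhomogeneous d p,
      0 < peval p e
    & forall (x : 'cV[R]_n) (z : R[i]),
        root (map_poly (real_complex R) (line_poly p x (- e))) z ->
        z \is Num.real].

(* When p is hyperbolic along e, every root of t |-> p(te - x) is real, so that
   only real roots have to be considered here and in [hrank]. *)
Definition hcone (R : realType) (n : nat) (p : mpoly n R) (e : 'cV[R]_n) :
    set 'cV[R]_n :=
  [set x | forall t : R, root (line_poly p (- x) e) t -> 0 <= t].

Definition hrank (R : realType) (n : nat) (p : mpoly n R) (e x : 'cV[R]_n) :
    nat :=
  let q := line_poly p (- x) e in
  (\sum_(t <- rootsR q | t != 0%R) mup t q)%N.

(* D_e^k p, with p(X + t e) seen as a polynomial in t over R[X_1, ..., X_n]. *)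
Definition dirderiv (R : realType) (n : nat) (k : nat) (e : 'cV[R]_n)
    (p : mpoly n R) : mpoly n R :=
  (mmap (fun c : R => (mpolyC n c)%:P)
     (fun i => (mpolyX R (mnm1 i))%:P + mpolyC n (e i 0) *: 'X) p)^`(k).[0].

Lemma dirderivE (R : realType) (n : nat) (k : nat) (e x : 'cV[R]_n)
    (p : mpoly n R) :
  peval (dirderiv k e p) x = (line_poly p x e)^`(k).[0].
Proof.
rewrite /peval /dirderiv.
set f := meval (fun i => x i 0) : {rmorphism mpoly n R -> R}.
rewrite -[LHS]/(f _) -horner_map rmorph0 -derivn_map.
congr (_^`(_).[_]).
rewrite /line_poly /mmap rmorph_sum /=; apply: eq_bigr => m _.
rewrite rmorphM /= map_polyC /= /f mevalC; congr (_ * _).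
rewrite /mmap1 rmorph_prod /=; apply: eq_bigr => i _.
by rewrite rmorphXn rmorphD /= map_polyC linearZ_LR /= map_polyX mevalXU mevalC.
Qed.

Definition derivative_cone (R : realType) (n : nat) (k : nat) (p : mpoly n R)
    (e : 'cV[R]_n) : set 'cV[R]_n :=
  hcone (dirderiv k e p) e.

Definition pointed (R : realType) (n : nat) (K : set 'cV[R]_n) : Prop :=
  K `&` [set - x | x in K] = [set 0].

Definition convex_cone (R : realType) (n : nat) (K : set 'cV[R]_n) : Prop :=
  (forall x y, K x -> K y -> K (x + y)) /\
  (forall (a : R) x, 0 <= a -> K x -> K (a *: x)).

(* The dimension of K is that of its affine hull, which for a nonempty convex
   cone is its linear hull: K contains a basis of it with m elements. *)
Definition cone_dim (R : realType) (n : nat) (K : set 'cV[R]_n) (m : nat) :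
    Prop :=
  exists b : m.-tuple 'cV[R]_n,
    [/\ free b,
        forall v, v \in b -> K v
      & forall v, K v -> v \in <<b>>%VS].

Definition regular_cone (R : realType) (n : nat) (K : set 'cV[R]_n) : Prop :=
  pointed K /\ cone_dim K n.

Definition cone_face (R : realType) (n : nat) (K F : set 'cV[R]_n) : Prop :=
  [/\ F !=set0, convex_cone F, F `<=` K
    & forall x y, K x -> K y -> F (x + y) -> F x /\ F y].

Definition extreme_ray (R : realType) (n : nat) (K F : set 'cV[R]_n) : Prop :=
  cone_face K F /\ cone_dim F 1.

Definition rank_one_generated (R : realType) (n : nat) (p : mpoly n R)
    (e : 'cV[R]_n) : Prop :=
  pointed (hcone p e) /\
  forall F, extreme_ray (hcone p e) F ->
    exists2 x : 'cV[R]_n, hrank p e x = 1%N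
      & F = [set a *: x | a in [set a : R | 0 <= a]].

Definition affine_hull (R : realType) (n : nat) (K : set 'cV[R]_n) :
    set 'cV[R]_n :=
  [set y | exists (m : nat) (v : 'I_m -> 'cV[R]_n) (a : 'I_m -> R),
     [/\ forall i, K (v i), \sum_i a i = 1 & y = \sum_i a i *: v i]].

Definition relint (R : realType) (n : nat) (K : set 'cV[R]_n) :
    set 'cV[R]_n :=
  [set x | K x /\ \forall y \near within (affine_hull K) (nbhs x), K y].

Definition cone_aut (R : realType) (n : nat) (K : set 'cV[R]_n) :
    set 'M[R]_n :=
  [set A | A \in unitmx /\ [set A *m x | x in K] = K].

Definition homogeneous_cone (R : realType) (n : nat) (K : set 'cV[R]_n) :
    Prop :=
  forall x y, relint K x -> relint K y ->
    exists2 A : 'M[R]_n, cone_aut K A & A *m x = y.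

(* Main.v *)
Require Import Defs.
From mathcomp Require Import all_boot all_order all_algebra.
From mathcomp Require Import complex polyrcf ring lra zify.
From mathcomp Require Import classical_sets reals topology boolp.
From mathcomp Require Import -(notations) mpoly.
From mathcomp Require Import -(notations) normedtype.

(** For a point x, let c_i(x) be the coefficient of t^i in p(x + t e), which is
    D_e^i p(x) up to the factor i!. The polynomial p(x + t e) and its derivatives
    in t are real-rooted, so the cone K of p is the set of x with c_i(x) >= 0 for
    all i, and its k-th derivative relaxation K_k is the set of x with
    c_i(x) >= 0 for all i >= k.

    An automorphism A of K_k maps every vector x of rank one of K into K. Indeed
    K_k is not smooth at x. Since p is affine along x ([low_rank_affine]), the
    directions w that are feasible at x satisfy Q(w) >= 0, where Q is the quadratic
    form w |-> c_(d-3)(w + x) - c_(d-3)(w); this uses k <= d - 3. If the feasible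
    directions filled a half space then Q, being even, would be nonnegative
    everywhere. But Q is affine along every vector of rank one, hence would be
    invariant under translations by such vectors, while e is a sum of them; this
    contradicts Q(e) > 0 = Q(0) ([rank_le1_not_smooth]). On the other hand K_k is
    smooth at each of its points z outside K: a double zero of D_e^k p(z + t e) at
    t = 0 would be a zero of p(z + t e) of multiplicity k + 2
    ([derivative_cone_mult2]), which forces z to lie in K.

    If K_k were homogeneous, then every interior point y of K_k would be A e for
    an automorphism A, hence a sum of images of vectors of rank one, so it would
    lie in K. But K_k is strictly larger than K: adding up the terms of a
    decomposition of e one by one, the multiplicity of the zero of p drops by at
    most one at each step, so that some partial sum z has multiplicity exactly
    one; such a z lies on the boundary of K and in the interior of K_k
    ([derivative_cone_larger]).

    Two classical ingredients are established on the way. The first is Gårding's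
    theorem, that p is hyperbolic along all interior directions of K, whence K is
    convex and p is monotone on it ([line_poly_int_gt0], [hconeD],
    [peval_mono]). It rests on the fact that the roots of a path of complex
    polynomials cannot leave the lower half plane without crossing the real axis
    ([lower_roots_path]). The second is that K is generated by its extreme rays
    ([hcone_rank_le1_sum]), by induction on the multiplicity of the zero of p:
    a vector off the extreme rays is the sum of two vectors of lower rank. *)

Set Implicit Arguments.
Unset Strict Implicit.
Unset Printing Implicit Defensive.

Import Order.TTheory GRing.Theory Num.Theory.
Import numFieldTopology.Exports numFieldNormedType.Exports.
Local Open Scope classical_set_scope.
Local Open Scope ring_scope.

(** * Real-rooted univariate polynomials *)

Section RealRooted.
Variable R : rcfType.
Implicit Types (f g : {poly R}) (rs : seq R).
Local Notation rc := (real_complex R).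

Definition real_rooted f : Prop :=
  forall z : R[i], root (map_poly rc f) z -> z \is Num.real.

Lemma real_rooted_split f : real_rooted f ->
  exists rs, f = lead_coef f *: \prod_(r <- rs) ('X - r%:P).
Proof.
move=> rrf.
have [zs fE] := closed_field_poly_normal (map_poly rc f).
have [f0|f0] := eqVneq f 0.
  by exists [::]; rewrite f0 lead_coef0 scale0r.
have zsr z : z \in zs -> z = rc (complex.Re z).
  move=> zz; have /rrf : root (map_poly rc f) z.
    by rewrite fE rootZ ?root_prod_XsubC// lead_coef_eq0 map_poly_eq0.
  by move/complex_realP => [x ->].
exists [seq complex.Re z | z <- zs].
apply: (map_poly_inj rc); rewrite [LHS]fE linearZ /= lead_coef_map.
congr (_ *: _); rewrite big_map rmorph_prod /= big_seq [RHS]big_seq.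
by apply: eq_bigr => z /zsr zE; rewrite rmorphB /= map_polyX map_polyC /= -zE.
Qed.

Lemma Im_inv_sub (r : R) (z : R[i]) : complex.Im z != 0 ->
  complex.Im (z - rc r)^-1 * complex.Im z < 0.
Proof.
case: z => a b /= b0; rewrite subr0 mulNr oppr_lt0 mulrAC -expr2 divr_gt0//.
  by rewrite exprn_even_gt0.
by rewrite ltr_wpDl ?sqr_ge0// exprn_even_gt0.
Qed.

(** Gauss-Lucas for a real-rooted product: at a non-real point z, every term of
    the logarithmic derivative sum 1 / (z - r) has an imaginary part of the sign
    opposite to that of z, so that the sum does not vanish. *)
Lemma log_deriv_prod rs (z : R[i]) : complex.Im z != 0 ->
  let g := map_poly rc (\prod_(r <- rs) ('X - r%:P)) in
  g.[z] != 0 /\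
  (if rs is [::] then g^`().[z] = 0
   else complex.Im (g^`().[z] / g.[z]) * complex.Im z < 0).
Proof.
move=> z0; elim: rs => [|r rs [g0 gI]] /=.
  by rewrite big_nil rmorph1 derivC hornerC horner0 oner_eq0.
rewrite big_cons; set h := \prod_(j <- rs) _ in g0 gI *.
have -> : map_poly rc (('X - r%:P) * h) = ('X - (rc r)%:P) * map_poly rc h.
  by rewrite rmorphM rmorphB /= map_polyX map_polyC.
move: (map_poly rc h) g0 gI => g g0 gI.
rewrite derivM derivXsubC mul1r hornerD !hornerM hornerXsubC.
have zr : z - rc r != 0.
  by apply: contra z0; rewrite subr_eq0 => /eqP ->.
split; first by rewrite mulf_neq0.
have -> : (g.[z] + (z - rc r) * g^`().[z]) / ((z - rc r) * g.[z]) =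
   (z - rc r)^-1 + g^`().[z] / g.[z] by field; rewrite g0 zr.
rewrite raddfD /= mulrDl; have H := Im_inv_sub r z0.
case: rs {h} gI => [|r' rs] gI; last by rewrite addrC ltr_wnDl// ltW.
by rewrite gI mul0r mul0r addr0.
Qed.

Lemma real_rooted_deriv f : (1 < size f)%N -> real_rooted f ->
  real_rooted f^`().
Proof.
move=> sf rrf z; have [rs fE] := real_rooted_split rrf.
have lf : lead_coef f != 0.
  by rewrite lead_coef_eq0; apply: contraTneq sf => ->; rewrite size_poly0.
case: (eqVneq (complex.Im z) 0) => [z0 _|z0].
  by apply/complex_realP; exists (complex.Re z); case: z z0 => a b /= ->.
rewrite fE derivZ linearZ /= rootZ ?fmorph_eq0// -deriv_map.
case: rs fE (log_deriv_prod rs z0) => [|r rs] fE [_ H].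
  by move: sf; rewrite fE big_nil size_scale// size_poly1.
by move=> /rootP g0; rewrite g0 mul0r mul0r ltxx in H.
Qed.

Lemma size_derivn_gt f k j : (k + j < size f)%N -> (j < size f^`(k))%N.
Proof.
move=> kj; rewrite ltnNge; apply/negP => s1.
have /eqP := coef_derivn k f ((size f).-1 - k).
have kf' : (k <= (size f).-1)%N by lia.
rewrite subnKC// -lead_coefE nth_default ?(leq_trans s1)//; last by lia.
rewrite eq_sym mulrn_eq0 -leqn0 leqNgt ffact_gt0 kf' /=.
by rewrite lead_coef_eq0 => /eqP f0; rewrite f0 size_poly0 in kj.
Qed.

Lemma real_rooted_derivn f k : (k < size f)%N -> real_rooted f ->
  real_rooted f^`(k).
Proof.
elim: k => [|k IH] kf rrf //; rewrite derivnS; apply: real_rooted_deriv.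
  by apply: size_derivn_gt; rewrite addn1.
by apply: IH => //; apply: ltnW.
Qed.

(** Newton's inequality at the three lowest coefficients: when a factor X - r is
    added, g_1^2 - 2 g_0 g_2 is multiplied by r^2 and increased by g_0^2. *)
Lemma newton_low rs (g := \prod_(r <- rs) ('X - r%:P)) :
  g`_0 != 0 -> (0 < size rs)%N -> 0 < g`_1 ^+ 2 - 2 * g`_0 * g`_2.
Proof.
have step r (h : {poly R}) : let G := ('X - r%:P) * h in
    [/\ G`_0 = - r * h`_0, G`_1 = h`_0 - r * h`_1 & G`_2 = h`_1 - r * h`_2].
  by rewrite /= mulrBl !coefB !coefXM !coefCM /= sub0r mulNr.
suff: g`_0 != 0 -> 0 <= g`_1 ^+ 2 - 2 * g`_0 * g`_2 /\
    ((0 < size rs)%N -> 0 < g`_1 ^+ 2 - 2 * g`_0 * g`_2).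
  by move=> H /H[].
rewrite {}/g; elim: rs => [|r rs IH].
  by rewrite big_nil !coef1 /= !mulr0 expr0n subr0.
rewrite big_cons; have [-> -> ->] := step r (\prod_(j <- rs) ('X - j%:P)).
set g := \prod_(j <- rs) _ in IH *.
rewrite mulf_eq0 negb_or => /andP[r0 g0].
have {}IH := (IH g0).1.
have -> : (g`_0 - r * g`_1) ^+ 2 - 2 * (- r * g`_0) * (g`_1 - r * g`_2) =
  g`_0 ^+ 2 + r ^+ 2 * (g`_1 ^+ 2 - 2 * g`_0 * g`_2) by ring.
have H : 0 < g`_0 ^+ 2 by rewrite exprn_even_gt0.
have H2 : 0 <= r ^+ 2 * (g`_1 ^+ 2 - 2 * g`_0 * g`_2).
  by rewrite mulr_ge0 ?sqr_ge0.
by split=> [|_]; [apply: addr_ge0 => //; apply: ltW | rewrite ltr_wpDr].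
Qed.

Lemma real_rooted_coef0 f : real_rooted f -> (1 < size f)%N ->
  f`_1 = 0 -> f`_2 = 0 -> f`_0 = 0.
Proof.
move=> /real_rooted_split[rs fE] sf f1 f2; apply/eqP; apply: contraLR sf => f0.
move: f0 f1 f2; rewrite fE !coefZ.
rewrite mulf_eq0 negb_or => /andP[l0 g0] /eqP; rewrite mulf_eq0 (negbTE l0) /=.
move=> /eqP g1 /eqP; rewrite mulf_eq0 (negbTE l0) /= => /eqP g2.
have := newton_low g0; rewrite g1 g2 mulr0 expr0n subr0 ltxx => H.
case: rs fE g0 g1 g2 H => [|r rs] fE _ _ _ H; last by have := H isT.
by rewrite big_nil size_scale// size_poly1.
Qed.

(** A vanishing pair of consecutive coefficients propagates downwards, by the
    previous lemma applied to the derivatives of f. *)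
Lemma real_rooted_coef_gap f k : real_rooted f -> (k.+1 < size f)%N ->
  f`_k = 0 -> f`_k.+1 = 0 -> forall j, (j <= k)%N -> f`_j = 0.
Proof.
elim: k f => [|k IH] f rrf sf fk fk1 j; first by rewrite leqn0 => /eqP ->.
have sf1 : (1 < size f)%N by lia.
have cf i : (f^`())`_i = f`_i.+1 *+ i.+1 by rewrite coef_deriv.
have IHf i : (i <= k)%N -> f`_i.+1 = 0.
  move=> ik; have : (f^`())`_i = 0.
    apply: IH => //; rewrite ?cf ?fk ?fk1 ?mul0rn//.
      exact: real_rooted_deriv.
    by rewrite -derivn1; apply: size_derivn_gt.
  by move/eqP; rewrite cf mulrn_eq0 /= => /eqP.
case: j => [_|j]; last by rewrite ltnS => /IHf.
apply: real_rooted_coef0 => //; first exact: IHf.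
by have [k0|k0] := posnP k; [move: fk1; rewrite k0 | exact: IHf].
Qed.

Lemma coef_ge0_horner_gt0 f : (forall i, 0 <= f`_i) -> 0 < lead_coef f ->
  forall s, 0 < s -> 0 < f.[s].
Proof.
move=> f0 lf s s0; rewrite horner_coef.
have sf : (0 < size f)%N by rewrite lt0n size_poly_eq0 -lead_coef_eq0 gt_eqF.
move: lf; rewrite /lead_coef; case: (size f) sf => // m _ /= lf.
rewrite big_ord_recr /= ltr_wpDl ?mulr_gt0 ?exprn_gt0//.
by apply: sumr_ge0 => i _; rewrite mulr_ge0// exprn_ge0// ltW.
Qed.

(** Multiplication by X - r with r <= 0 preserves both the nonnegativity of the
    coefficients and their positivity from some index up to the top. *)
Lemma prod_nonpos_coef rs (g := \prod_(r <- rs) ('X - r%:P)) :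
  (forall r, r \in rs -> r <= 0) ->
  (forall i, 0 <= g`_i) /\
  (forall i j, (i <= j <= size rs)%N -> 0 < g`_i -> 0 < g`_j).
Proof.
rewrite /g; elim: rs {g} => [|r rs IH] rs0.
  rewrite big_nil; split=> [i|[|i] [|j]]; rewrite ?coef1//.
have [|g0 gg] := IH; first by move=> x xr; rewrite rs0// inE xr orbT.
have r0 : r <= 0 by rewrite rs0// inE eqxx.
rewrite big_cons; set g := \prod_(j <- rs) _ in g0 gg *.
have cE i : (('X - r%:P) * g)`_i = (if i is i'.+1 then g`_i' else 0) + - r * g`_i.
  by rewrite mulrBl coefB coefXM coefCM mulNr; case: i.
split=> [i|i j /andP[ij js]].
  by rewrite cE addr_ge0 ?mulr_ge0 ?oppr_ge0//; case: i.
rewrite !cE => H.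
have lo l : 0 <= (if l is l'.+1 then g`_l' else 0) by case: l.
have hi l : 0 <= - r * g`_l by rewrite mulr_ge0 ?oppr_ge0.
have [lt0|] := ltP 0 (if i is i'.+1 then g`_i' else 0).
  case: i j ij js lt0 {H} => [|i] [|j] //; rewrite ?ltxx// => ij js lt0.
  by rewrite ltr_wpDr// (gg i)//; move: ij js => /=; lia.
rewrite le_eqVlt ltNge lo orbF => /eqP i0; rewrite i0 add0r in H.
have gi : 0 < g`_i.
  by rewrite lt0r g0 andbT; apply: contraTneq H => ->; rewrite mulr0 ltxx.
have r1 : 0 < - r by rewrite -(pmulr_lgt0 _ gi).
have [jj|jj] := leqP j (size rs).
  by rewrite ltr_wpDl// mulr_gt0// (gg i)// ij jj.
have jE : j = (size rs).+1 by apply/eqP; rewrite eqn_leq js jj.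
rewrite jE ltr_wpDr// (gg i)// leqnn andbT.
rewrite leqNgt; apply/negP => si.
by move: gi; rewrite nth_default ?ltxx// size_prod_XsubC.
Qed.

(** Without positive roots, f is a positive multiple of a product of factors
    X - r with r <= 0. *)
Lemma real_rooted_coef_ge0 f : real_rooted f -> 0 < lead_coef f ->
  (forall s, 0 < s -> f.[s] != 0) ->
  (forall i, 0 <= f`_i) /\
  (forall i j, (i <= j < size f)%N -> 0 < f`_i -> 0 < f`_j).
Proof.
move=> rrf lf nf; have [rs fE] := real_rooted_split rrf.
have l0 : lead_coef f != 0 by rewrite gt_eqF.
have sf : size f = (size rs).+1 by rewrite fE size_scale// size_prod_XsubC.
have rs0 r : r \in rs -> r <= 0.
  move=> rrs; rewrite leNgt; apply/negP => /nf /negP; apply.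
  by rewrite -rootE fE rootZ// root_prod_XsubC.
have [g0 gg] := prod_nonpos_coef rs0.
rewrite sf {sf}; move: (lead_coef f) fE lf {nf rrf l0} => c -> c0.
split=> [i|i j]; first by rewrite coefZ mulr_ge0// ltW.
by rewrite ltnS !coefZ !pmulr_rgt0//; exact: gg.
Qed.

End RealRooted.

(** * Sign and growth of real polynomials *)

Section PolyGrowth.
Variable R : rcfType.
Implicit Types (f g : {poly R}).

Lemma horner0_ge0 f (d : R) : 0 < d ->
  (forall s, 0 < s -> s < d -> 0 <= f.[s]) -> 0 <= f.[0].
Proof.
move=> d0 fs; rewrite leNgt; apply/negP => f0.
have [|e e0 he] := @poly_cont _ 0 f (- f.[0]); first by rewrite oppr_gt0.
pose s := Num.min e d / 2.
have m0 : 0 < Num.min e d by rewrite lt_min e0 d0.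
have s0 : 0 < s by rewrite divr_gt0.
have sm : s < Num.min e d by rewrite /s; lra.
move: sm; rewrite lt_min => /andP[se sd].
have := he s; rewrite subr0 gtr0_norm// => /(_ se).
have := fs s s0 sd; move=> h1 h2.
have := ler_norm (f.[s] - f.[0]); lra.
Qed.

Lemma horner_gt0_near0 f : 0 < f.[0] ->
  exists2 d : R, 0 < d & forall s, `|s| < d -> 0 < f.[s].
Proof.
move=> f0; have [d d0 hd] := poly_cont 0 f f0; exists d => // s sd.
have := hd s; rewrite subr0 => /(_ sd).
by rewrite distrC => h; have := ler_norm (f.[0] - f.[s]); lra.
Qed.

Lemma poly_eq0_itv f (d : R) : 0 < d ->
  (forall s, 0 < s -> s < d -> f.[s] = 0) -> f = 0.
Proof.
move=> d0 fs; apply/eqP; apply: contraT => f0.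
(* More points of the interval than f can have roots. *)
pose rs := [seq d / i.+2%:R | i <- iota 0 (size f)].
have: (size rs < size f)%N.
  apply: max_poly_roots => //.
    apply/allP => _ /mapP[i _ ->]; apply/rootP/fs.
      by rewrite divr_gt0// ltr0n.
    by rewrite ltr_pdivrMr ?ltr0n// ltr_pMr// ltr1n.
  rewrite map_inj_uniq ?iota_uniq// => i j /(mulfI (lt0r_neq0 d0)) /invr_inj.
  by move/eqP; rewrite eqr_nat => /eqP[].
by rewrite size_map size_iota ltnn.
Qed.

Lemma poly_ext f g : (forall s : R, 0 < s -> f.[s] = g.[s]) -> f = g.
Proof.
move=> fg; apply/eqP; rewrite -subr_eq0; apply/eqP.
apply: (poly_eq0_itv ltr01) => s s0 _.
by rewrite hornerD hornerN fg// subrr.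
Qed.

(** Dividing both polynomials by the variable lowers m; the constant coefficient
    of f vanishes with that of g by comparison at 0. *)
Lemma coef_dominated f g (d : R) m : 0 < d -> (forall i, 0 <= f`_i) ->
  (forall s, 0 < s -> s < d -> f.[s] <= g.[s]) ->
  (forall i, (i < m)%N -> g`_i = 0) ->
  forall i, (i < m)%N -> f`_i = 0.
Proof.
move=> d0; elim: m f g => [|m IH] f g // f0 fg g0.
have split0 (h : {poly R}) : h`_0 = 0 -> exists h', h = h' * 'X.
  move=> h0; exists (h %/ 'X); rewrite divpK//.
  by rewrite -['X]subr0 dvdp_XsubCl rootE horner_coef0 h0.
have [g' gE] := split0 g (g0 0 isT).
have f00 : f`_0 = 0.
  apply/eqP; rewrite eq_le f0 andbT -oppr_ge0.
  have := @horner0_ge0 (g - f) d d0; rewrite hornerD hornerN !horner_coef0.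
  rewrite (g0 0)// sub0r; apply => s s0 sd.
  by rewrite hornerD hornerN subr_ge0 fg.
have [f' fE] := split0 f f00.
have cf i : f`_i.+1 = f'`_i by rewrite fE coefMX.
have cg i : g`_i.+1 = g'`_i by rewrite gE coefMX.
case=> [//|i]; rewrite ltnS => im; rewrite cf; apply: (IH f' g') => //.
- by move=> j; rewrite -cf.
- move=> s s0 sd; have := fg s s0 sd.
  by rewrite fE gE !hornerMX ler_pM2r.
- by move=> j jm; rewrite -cg g0.
Qed.

Lemma lead_coef_ge0 f : (forall s : R, 0 < s -> 0 <= f.[s]) ->
  0 <= lead_coef f.
Proof.
move=> fs; rewrite leNgt; apply/negP => lf.
have [|n hn] := @poly_pinfty_gt_lc _ (- f).
  by rewrite lead_coefN oppr_gt0.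
pose x := Num.max n 1.
have x0 : 0 < x by rewrite lt_max ltr01 orbT.
have := hn x; rewrite le_max lexx hornerN lead_coefN lerN2 => /(_ isT).
have := fs x x0; lra.
Qed.

Lemma size_le2_bounded f (a b : R) :
  (forall s, 0 < s -> 0 <= f.[s] <= a + b * s) -> (size f <= 2)%N.
Proof.
move=> fs; rewrite leqNgt; apply/negP => sf.
have lf : 0 <= lead_coef f by apply: lead_coef_ge0 => s /fs/andP[].
have : 0 <= lead_coef ((b *: 'X + a%:P) - f).
  apply: lead_coef_ge0 => s /fs/andP[_].
  by rewrite !hornerE addrC subr_ge0.
rewrite addrC lead_coefDl ?size_polyN ?(leq_ltn_trans _ sf)//; last first.
  rewrite (leq_trans (size_polyD _ _))// geq_max.
  rewrite (leq_trans (size_scale_leq _ _)) ?size_polyX//.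
  by rewrite (leq_trans (size_polyC_leq1 _)).
rewrite lead_coefN oppr_ge0 => lf'.
have /eqP : lead_coef f = 0 by apply/eqP; rewrite eq_le lf lf'.
by rewrite lead_coef_eq0 => /eqP f0; rewrite f0 size_poly0 in sf.
Qed.

End PolyGrowth.

(** * Paths of complex polynomials whose roots avoid the real axis *)

Section RootPaths.
Variable R : realType.
Local Notation C := R[i].
Local Notation rc := (real_complex R).
Local Notation N := (@Normc.normc R).
Implicit Types (F G : {poly C}) (z w : C).

Lemma normc_mul z w : N (z * w) = N z * N w.
Proof. exact: Normc.normcM. Qed.

Lemma normc_ge0 z : 0 <= N z.
Proof. by case: z => a b; apply: sqrtr_ge0. Qed.

Lemma normc_triangle z w : N (z + w) <= N z + N w.
Proof. exact: (le_normcD z w). Qed.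

Lemma normc_opp z : N (- z) = N z.
Proof. exact: (normcN z). Qed.

Lemma normc_real (a : R) : N (rc a) = `|a|.
Proof. by rewrite /= expr0n addr0 sqrtr_sqr. Qed.

Lemma normc_gt0 z : z != 0 -> 0 < N z.
Proof.
move=> z0; rewrite lt0r normc_ge0 andbT.
by apply: contra z0 => /eqP/Normc.eq0_normc ->.
Qed.

Lemma normc_exp z n : N (z ^+ n) = N z ^+ n.
Proof.
elim: n => [|n IH]; first by rewrite !expr0 Normc.normc1.
by rewrite !exprS normc_mul IH.
Qed.

Lemma normc_sum (I : Type) (r : seq I) (E : I -> C) :
  N (\sum_(i <- r) E i) <= \sum_(i <- r) N (E i).
Proof.
elim: r => [|i r IH]; first by rewrite !big_nil Normc.normc0.
by rewrite !big_cons (le_trans (normc_triangle _ _))// lerD2l.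
Qed.

Lemma normc_ge_Im z : `|complex.Im z| <= N z.
Proof.
case: z => a b /=; rewrite -sqrtr_sqr ler_sqrt ?addr_ge0 ?sqr_ge0//.
by rewrite lerDr sqr_ge0.
Qed.

(** Up to the leading coefficient, the value of F at z is the product of the
    distances from z to the roots; if it is small then so is one of them. *)
Lemma root_near F z (eta : R) : F != 0 -> 0 <= eta ->
  N F.[z] < N (lead_coef F) * eta ^+ (size F).-1 ->
  exists2 w, root F w & N (z - w) < eta.
Proof.
move=> F0 eta0; have [ws FE] := closed_field_poly_normal F.
have c0 : lead_coef F != 0 by rewrite lead_coef_eq0.
have sF : (size F).-1 = size ws by rewrite FE size_scale// size_prod_XsubC.
rewrite sF {1}FE hornerZ normc_mul ltr_pM2l ?normc_gt0// => Fz.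
suff [w ww zw] : exists2 w, w \in ws & N (z - w) < eta.
  by exists w => //; rewrite FE rootZ// root_prod_XsubC.
elim: ws Fz {FE sF} => [|w ws IH].
  by rewrite big_nil hornerC Normc.normc1 expr0 ltxx.
rewrite big_cons hornerM normc_mul hornerXsubC /= exprS => Fz.
have [zw|zw] := ltP (N (z - w)) eta; first by exists w; rewrite ?mem_head.
have [|w' ww' zw'] := IH; last by exists w' => //; rewrite inE ww' orbT.
rewrite ltNge; apply/negP => H; move: Fz; rewrite ltNge => /negP; apply.
by rewrite ler_pM// exprn_ge0.
Qed.

Lemma root_bound F z (A : R) : F != 0 -> (forall j, N F`_j <= A) ->
  root F z -> N z <= 1 + (size F)%:R * A / N (lead_coef F).
Proof.
move=> F0 FA Fz.
have c0 : 0 < N (lead_coef F) by rewrite normc_gt0// lead_coef_eq0.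
have A0 : 0 <= A by apply: le_trans (normc_ge0 _) (FA 0%N).
have pos : 0 <= (size F)%:R * A / N (lead_coef F).
  by rewrite divr_ge0 ?mulr_ge0// ltW.
have [z1|z1] := leP (N z) 1; first by rewrite (le_trans z1)// lerDl.
rewrite -[N z]add0r lerD//.
have zp k : 0 < N z ^+ k by rewrite exprn_gt0// (lt_trans ltr01).
move: Fz; rewrite rootE horner_coef.
have sF : (0 < size F)%N by rewrite size_poly_gt0.
move: c0; rewrite /lead_coef; case E: (size F) sF => [//|m] _ /= c0.
rewrite big_ord_recr /= addr_eq0 => /eqP Fz.
have : N F`_m * N z ^+ m <= \sum_(i < m) A * N z ^+ m.-1.
  rewrite -normc_exp -normc_mul -normc_opp -Fz (le_trans (normc_sum _ _))//.
  apply: ler_sum => i _; rewrite normc_mul normc_exp.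
  rewrite ler_pM ?normc_ge0 ?exprn_ge0 ?normc_ge0//.
  rewrite ler_eXn2l//; move: (ltn_ord i); lia.
rewrite sumr_const card_ord; case: m E Fz c0 => [|m] E Fz c0 /=.
  by rewrite mulr0n expr0 mulr1 leNgt c0.
rewrite -mulrnAl exprS mulrA ler_pM2r// => H.
rewrite ler_pdivlMr// mulrC (le_trans H)// -mulr_natl ler_wpM2r// ler_nat//.
Qed.

Lemma Im_away_from0 F : F != 0 ->
  (forall z, root F z -> complex.Im z != 0) ->
  exists2 eta : R, 0 < eta & forall z, root F z -> eta <= `|complex.Im z|.
Proof.
move=> F0; have [ws FE] := closed_field_poly_normal F.
have rF z : root F z = (z \in ws).
  by rewrite FE rootZ ?lead_coef_eq0// root_prod_XsubC.
suff: (forall z, z \in ws -> complex.Im z != 0) ->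
  exists2 eta : R, 0 < eta & forall z, z \in ws -> eta <= `|complex.Im z|.
  move=> H h; have [z zz|eta eta0 h'] := H; first by apply: h; rewrite rF.
  by exists eta => // z; rewrite rF; apply: h'.
elim: ws {FE rF} => [_|w ws IH ws0]; first by exists 1.
have [|eta eta0 h] := IH; first by move=> z zw; rewrite ws0// inE zw orbT.
exists (Num.min eta `|complex.Im w|).
  by rewrite lt_min eta0 normr_gt0 ws0// mem_head.
by move=> z; rewrite inE ge_min => /orP[/eqP->|/h ->//]; rewrite lexx orbT.
Qed.

Lemma itv01_locally_constant (S : R -> Prop) :
  (forall t, 0 <= t <= 1 -> exists2 d : R, 0 < d &
     forall t', 0 <= t' <= 1 -> `|t - t'| < d -> (S t <-> S t')) ->
  S 0 -> S 1.
Proof.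
move=> Sloc S0.
pose T : set R := fun t => 0 <= t <= 1 /\ forall t', 0 <= t' <= t -> S t'.
have T0 : T 0.
  split; first by rewrite lexx ler01.
  by move=> t' H; have -> : t' = 0 by apply: le_anti; rewrite andbC.
have supT : has_sup T by split; [exists 0 | exists 1 => t [/andP[]]].
pose s := sup T.
have s01 : 0 <= s <= 1.
  rewrite (ub_le_sup supT.2 T0)/= ge_sup//; first by exists 0.
  by move=> t [/andP[]].
have [d d0 hd] := Sloc s s01.
have [t Tt tsd] := sup_adherent d0 supT.
have ts : t <= s by apply: ub_le_sup => //; exact: supT.2.
have Ss : S s.
  apply/(hd t).
  - exact: Tt.1.
  - by rewrite ger0_norm ?subr_ge0// ltrBlDr addrC -ltrBlDr.
  - by apply: Tt.2; have /andP[-> _] := Tt.1; rewrite lexx.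
have ext t' : 0 <= t' <= 1 -> t' < s + d -> S t'.
  move=> t'01 t'sd; have [t't|tt'] := leP t' t.
    by apply: Tt.2; move: t'01 => /andP[->].
  apply/(hd t') => //; rewrite ltr_distlC; apply/andP; split; last by [].
  by apply: le_lt_trans tt'; apply: ltW.
have [s1|s1] := leP 1 s.
  by apply: ext; rewrite ?ler01 ?lexx// (le_lt_trans s1)// ltrDl.
pose u := Num.min 1 (s + d / 2).
have su : s < u by rewrite lt_min s1 ltrDl divr_gt0.
have u1 : u <= 1 by rewrite ge_min lexx.
have usd : u < s + d.
  by rewrite (@le_lt_trans _ _ (s + d / 2)) ?ge_min ?lexx ?orbT//; lra.
have : T u.
  split; first by rewrite u1 (le_trans _ (ltW su)); case/andP: s01.
  move=> t' /andP[t'0 t'u]; apply: ext; last exact: le_lt_trans usd.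
  by rewrite t'0 (le_trans t'u).
by move=> /(ub_le_sup supT.2); rewrite -/s leNgt su.
Qed.

(** Paths of polynomials with Lipschitz coefficients and a fixed nonzero leading
    coefficient: no root escapes to infinity along them. *)
Variables (f : R -> {poly C}) (d : nat) (c : C) (M : R).
Hypothesis c_neq0 : c != 0.
Hypothesis fsize : forall t, size (f t) = d.+1.
Hypothesis flead : forall t, lead_coef (f t) = c.
Hypothesis M_ge0 : 0 <= M.
Hypothesis flip : forall t t' j, 0 <= t <= 1 -> 0 <= t' <= 1 ->
  N ((f t)`_j - (f t')`_j) <= M * `|t - t'|.

Let f_neq0 t : f t != 0.
Proof. by rewrite -size_poly_eq0 fsize. Qed.

Lemma path_horner_lip (B : R) : 1 <= B -> exists2 L : R, 0 < L &
  forall t t' z, 0 <= t <= 1 -> 0 <= t' <= 1 -> N z <= B ->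
    N ((f t).[z] - (f t').[z]) <= L * `|t - t'|.
Proof.
move=> B1; have B0 : 0 <= B by apply: le_trans B1.
exists (1 + d.+1%:R * M * B ^+ d).
  by rewrite ltr_wpDr ?mulr_ge0 ?exprn_ge0.
move=> t t' z t01 t'01 zB; rewrite !horner_coef !fsize -sumrB.
rewrite (le_trans (normc_sum _ _))// mulrDl ler_wpDl ?mulr_ge0//.
have -> : d.+1%:R * M * B ^+ d * `|t - t'| =
    \sum_(i < d.+1) M * `|t - t'| * B ^+ d.
  by rewrite sumr_const card_ord -mulr_natl; ring.
apply: ler_sum => i _; rewrite -mulrBl normc_mul normc_exp.
rewrite ler_pM ?normc_ge0 ?exprn_ge0 ?normc_ge0//.
  exact: flip.
apply: (@le_trans _ _ (B ^+ i)); first by rewrite lerXn2r ?nnegrE ?normc_ge0.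
by rewrite ler_weXn2l// -ltnS.
Qed.

Lemma path_root_bound : exists2 B : R, 1 <= B &
  forall t z, 0 <= t <= 1 -> root (f t) z -> N z <= B.
Proof.
pose A := \sum_(i < d.+1) N (f 0)`_i + M.
have A0 : 0 <= A by rewrite addr_ge0// sumr_ge0// => i _; rewrite normc_ge0.
exists (1 + d.+1%:R * A / N c); first by rewrite lerDl divr_ge0 ?mulr_ge0 ?normc_ge0.
move=> t z t01 tz; rewrite -(fsize t) -(flead t); apply: root_bound => // j.
have -> : (f t)`_j = (f 0)`_j + ((f t)`_j - (f 0)`_j) by rewrite addrC subrK.
rewrite (le_trans (normc_triangle _ _))// lerD//.
  have [jd|jd] := ltnP j d.+1.
    rewrite (bigD1 (Ordinal jd))//= lerDl sumr_ge0// => i _.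
    by rewrite normc_ge0.
  rewrite nth_default ?fsize// Normc.normc0 sumr_ge0// => i _.
  by rewrite normc_ge0.
have z01 : (0 : R) <= (0 : R) <= (1 : R) by rewrite lexx ler01.
rewrite (le_trans (flip _ t01 z01))// subr0 ler_piMr//.
by case/andP: t01 => t0 t1; rewrite ger0_norm.
Qed.

(** A root of f t is almost a root of f t', hence close to one. *)
Lemma upper_root_persists t z : 0 <= t <= 1 -> root (f t) z ->
  0 < complex.Im z -> exists2 e : R, 0 < e & forall t', 0 <= t' <= 1 ->
    `|t - t'| < e -> exists2 w, root (f t') w & 0 < complex.Im w.
Proof.
move=> t01 tz z0; set eta := complex.Im z in z0.
have [|L L0 hL] := @path_horner_lip (1 + N z); first by rewrite lerDl normc_ge0.
exists (N c * eta ^+ d / L); first by rewrite !(divr_gt0, mulr_gt0, exprn_gt0) ?normc_gt0.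
move=> t' t'01; rewrite ltr_pdivlMr// => tt'.
have [|w tw zw] := @root_near (f t') z eta (f_neq0 _) (ltW z0).
  rewrite flead fsize /= (le_lt_trans _ tt')// mulrC distrC.
  have /eqP tz0 := tz; rewrite -[_.[z]]subr0 -{1}tz0.
  by apply: hL => //; rewrite ler_wpDl.
exists w => //; have := le_lt_trans (normc_ge_Im _) zw.
by rewrite raddfB /= -/eta ltr_distl; lra.
Qed.

(** A root of f t' is almost a root of f t, hence close to one; it is bounded
    independently of t', which makes this uniform. *)
Lemma lower_roots_persist t : 0 <= t <= 1 ->
  (forall z, root (f t) z -> complex.Im z < 0) ->
  exists2 e : R, 0 < e & forall t', 0 <= t' <= 1 -> `|t - t'| < e ->
    forall z, root (f t') z -> complex.Im z < 0.
Proof.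
move=> t01 tI.
have [|eta eta0 heta] := @Im_away_from0 (f t) (f_neq0 _).
  by move=> z /tI; rewrite lt_neqAle => /andP[].
have [B B1 hB] := path_root_bound.
have [L L0 hL] := path_horner_lip B1.
exists (N c * eta ^+ d / L); first by rewrite !(divr_gt0, mulr_gt0, exprn_gt0) ?normc_gt0.
move=> t' t'01; rewrite ltr_pdivlMr// => tt' z t'z.
have [|w tw zw] := @root_near (f t) z eta (f_neq0 _) (ltW eta0).
  rewrite flead fsize /= (le_lt_trans _ tt')// mulrC.
  have /eqP tz0 := t'z; rewrite -[_.[z]]subr0 -{1}tz0.
  by apply: hL => //; apply: hB t'z.
have := heta w tw; have := tI w tw; move=> w0; rewrite ltr0_norm// => weta.
by have := le_lt_trans (normc_ge_Im _) zw; rewrite raddfB /= ltr_distl; lra.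
Qed.

(** By the two previous lemmas, having all roots in the lower half plane is a
    locally constant property of the parameter. *)
Lemma lower_roots_path :
  (forall t z, 0 <= t <= 1 -> root (f t) z -> complex.Im z != 0) ->
  (forall z, root (f 0) z -> complex.Im z < 0) ->
  forall z, root (f 1) z -> complex.Im z < 0.
Proof.
move=> nreal; apply: (@itv01_locally_constant
  (fun t => forall z, root (f t) z -> complex.Im z < 0)) => t t01.
have [low|] := pselect (forall z, root (f t) z -> complex.Im z < 0).
  by have [e e0 he] := lower_roots_persist t01 low; exists e => // t' *;
    split=> // _; apply: he.
move=> /existsNP[z /not_implyP[tz /negP]]; rewrite -leNgt le_eqVlt eq_sym.
rewrite (negbTE (nreal t z t01 tz)) /= => z0.
have [e e0 he] := upper_root_persists t01 tz z0.
exists e => // t' t'01 tt'; split=> [/(_ z tz)|].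
  by rewrite ltNge ltW.
have [w t'w w0] := he t' t'01 tt'.
by move=> /(_ w t'w); rewrite ltNge ltW.
Qed.

End RootPaths.

(** * Evaluation of a homogeneous polynomial along lines *)

Section MmapLines.
Variables (n : nat) (R S : comNzRingType).
Implicit Types (p : mpoly n R).

Lemma rmorph_mmap (T : comNzRingType) (g : {rmorphism S -> T}) (f : R -> S)
    (h : 'I_n -> S) p : g (mmap f h p) = mmap (g \o f) (g \o h) p.
Proof.
rewrite /mmap rmorph_sum /=; apply: eq_bigr => m _; rewrite rmorphM /=.
congr (_ * _); rewrite /mmap1 rmorph_prod /=; apply: eq_bigr => i _.
by rewrite rmorphXn.
Qed.

Lemma mmap_ext (f1 f2 : R -> S) (h1 h2 : 'I_n -> S) p :
  f1 =1 f2 -> h1 =1 h2 -> mmap f1 h1 p = mmap f2 h2 p.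
Proof.
move=> ef eh; rewrite /mmap; apply: eq_bigr => m _; rewrite ef; congr (_ * _).
by rewrite /mmap1; apply: eq_bigr => i _; rewrite eh.
Qed.

Variables (d : nat) (p : mpoly n R).
Hypothesis hom_p : p \is ishomog1 d mdeg.

Lemma homog_deg m : m \in msupp p -> d = (\sum_i m i)%N.
Proof. by move=> mp; rewrite -mdegE -[LHS](dhomog_mf hom_p mp). Qed.

Lemma mmap_homog (f : R -> S) (h : 'I_n -> S) (c : S) :
  mmap f (fun i => c * h i) p = c ^+ d * mmap f h p.
Proof.
rewrite /mmap mulr_sumr big_seq [RHS]big_seq; apply: eq_bigr => m mp.
rewrite mulrCA; congr (_ * _).
rewrite [d](homog_deg mp) /mmap1 expr_sum -big_split /=.
by apply: eq_bigr => i _; rewrite exprMn.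
Qed.

(** The terms of p are products of d linear forms along a line, so that the
    coefficient of degree d is the value of p at the direction. *)
Lemma mmap_line_top (f : R -> S) (x w : 'I_n -> S) :
  let q := mmap (fun c => (f c)%:P) (fun i => (x i)%:P + w i *: 'X) p in
  (size q <= d.+1)%N /\ q`_d = mmap f w p.
Proof.
have topM (A B : {poly S}) a b : (size A <= a.+1)%N -> (size B <= b.+1)%N ->
    (size (A * B)%R <= (a + b).+1)%N /\ (A * B)`_(a + b) = A`_a * B`_b.
  move=> sA sB; split.
    by rewrite (leq_trans (size_polyMleq _ _))//; lia.
  have sa : (a < (a + b).+1)%N by lia.
  rewrite coefM (bigD1 (Ordinal sa))//= addKn big1 ?addr0// => i.
  rewrite -val_eqE /= => ia; have [lt_ia|le_ai] := ltnP i a.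
    by rewrite [B`__]nth_default ?mulr0// (leq_trans sB)//; lia.
  by rewrite nth_default ?mul0r// (leq_trans sA)//; lia.
have top_lin i : (size ((x i)%:P + w i *: 'X : {poly S})%R <= 2)%N /\
    ((x i)%:P + w i *: 'X : {poly S})`_1 = w i.
  rewrite coefD coefC coefZ coefX /= add0r mulr1; split=> //.
  rewrite (leq_trans (size_polyD _ _))// geq_max.
  rewrite (leq_trans (size_polyC_leq1 _))//.
  by rewrite (leq_trans (size_scale_leq _ _))// size_polyX.
have topX i k : let F := ((x i)%:P + w i *: 'X) ^+ k : {poly S} in
    (size F <= k.+1)%N /\ F`_k = w i ^+ k.
  elim: k => [|k [sk ck]] /=; first by rewrite !expr0 size_poly1 coef1.
  have [s1 c1] := top_lin i; have := topM _ _ _ _ s1 sk.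
  by rewrite !exprS add1n c1 ck.
rewrite /=; split.
  apply: (leq_trans (size_sum _ _ _)); apply/bigmax_leqP_seq => m mp _.
  rewrite (leq_trans (size_polyMleq _ _))//.
  have : (size (mmap1 (fun i => ((x i)%:P + w i *: 'X)%R) m) <= d.+1)%N.
    rewrite [d](homog_deg mp) /mmap1.
    elim/big_rec2: _ => [|i k F _ sF]; first by rewrite size_poly1.
    by have [+ _] := topM _ _ _ _ (topX i (m i)).1 sF.
  move=> sm; have s1 := size_polyC_leq1 (f (mcoeff m p)).
  by have := leq_add s1 sm; rewrite add1n -subn1 leq_subLR add1n.
rewrite /mmap coef_sum big_seq [RHS]big_seq; apply: eq_bigr => m mp.
rewrite coefCM; congr (_ * _).
suff [] : (size (mmap1 (fun i => ((x i)%:P + w i *: 'X)%R) m) <= d.+1)%N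
  /\ (mmap1 (fun i => (x i)%:P + w i *: 'X) m)`_d = mmap1 w m by [].
rewrite [d](homog_deg mp) /mmap1.
elim/big_rec3: _ => [|i a b F _ [sF <-]]; first by rewrite size_poly1 coef1.
by have := topM _ _ _ _ (topX i (m i)).1 sF; rewrite (topX i (m i)).2.
Qed.

End MmapLines.

Section RealLines.
Variables (R : realType) (n : nat) (d : nat) (p : mpoly n R).
Hypothesis hom_p : mhomogeneous d p.
Implicit Types (x v : 'cV[R]_n).

Lemma peval_homog (a : R) x : peval p (a *: x) = a ^+ d * peval p x.
Proof.
rewrite /peval /meval -(mmap_homog hom_p).
by apply: mmap_ext => // i; rewrite mxE.
Qed.

Lemma line_poly_top x v :
  (size (line_poly p x v) <= d.+1)%N /\ (line_poly p x v)`_d = peval p v.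
Proof. exact: (mmap_line_top hom_p id (fun i => x i 0) (fun i => v i 0)). Qed.

Lemma line_poly_lead x v : peval p v != 0 ->
  size (line_poly p x v) = d.+1 /\ lead_coef (line_poly p x v) = peval p v.
Proof.
move=> v0; have [s c] := line_poly_top x v.
have sE : size (line_poly p x v) = d.+1.
  apply/eqP; rewrite eqn_leq s /= ltnNge; apply: contra v0 => s'.
  by rewrite -c nth_default.
by split=> //; rewrite /lead_coef sE.
Qed.

End RealLines.

(** * Complex points *)

Section ComplexPoints.
Variables (R : realType) (n d : nat) (p : mpoly n R).
Hypothesis hom_p : mhomogeneous d p.
Local Notation rc := (real_complex R).
Local Notation C := R[i].
Implicit Types (x v : 'cV[R]_n) (U V W : 'cV[C]_n).

Definition cpeval W : C := mmap rc (fun i => W i 0) p.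
Definition cvec x : 'cV[C]_n := map_mx rc x.

Lemma cvecD x v : cvec (x + v) = cvec x + cvec v.
Proof. exact: map_mxD. Qed.

Lemma cvecZ (a : R) x : cvec (a *: x) = rc a *: cvec x.
Proof. exact: map_mxZ. Qed.

Lemma cpeval_homog (c : C) W : cpeval (c *: W) = c ^+ d * cpeval W.
Proof.
by rewrite /cpeval -(mmap_homog hom_p); apply: mmap_ext => // i; rewrite mxE.
Qed.

Lemma cpeval_line x v (z : C) :
  cpeval (cvec x + z *: cvec v) = (map_poly rc (line_poly p x v)).[z].
Proof.
rewrite -[RHS]/((horner_eval z \o map_poly rc) _) [RHS]rmorph_mmap.
apply: mmap_ext => [c|i] /=.
  by rewrite map_polyC /= /horner_eval hornerC.
rewrite /horner_eval rmorphD /= map_polyC linearZ /= map_polyX.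
by rewrite hornerD hornerZ hornerC hornerX !mxE mulrC.
Qed.

Lemma cpeval_cvec x : cpeval (cvec x) = rc (peval p x).
Proof.
by rewrite [RHS]rmorph_mmap; apply: mmap_ext => // i; rewrite /= mxE.
Qed.

Definition plane_poly U V W : {poly {poly C}} :=
  mmap (fun c => ((rc c)%:P)%:P)
    (fun i => ((U i 0)%:P + V i 0 *: 'X)%:P + (W i 0)%:P *: 'X) p.

Definition plane_path U V W (t : R) : {poly C} :=
  map_poly (horner_eval (rc t)) (plane_poly U V W).

Lemma plane_pathE U V W t : plane_path U V W t =
  mmap (fun c => (rc c)%:P) (fun i => ((U + rc t *: V) i 0)%:P + W i 0 *: 'X) p.
Proof.
rewrite [LHS]rmorph_mmap; apply: mmap_ext => [c|i] /=.
  by rewrite map_polyC /= /horner_eval hornerC.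
rewrite rmorphD /= map_polyC linearZ /= map_polyX /horner_eval /= hornerC.
by rewrite hornerD hornerZ hornerC hornerX !mxE [rc t * _]mulrC.
Qed.

Lemma horner_plane_path U V W t (z : C) :
  (plane_path U V W t).[z] = cpeval (U + rc t *: V + z *: W).
Proof.
rewrite plane_pathE -[LHS]/(horner_eval z _) rmorph_mmap.
apply: mmap_ext => [c|i] /=; rewrite /horner_eval ?hornerC//.
by rewrite hornerD hornerZ hornerC hornerX !mxE [z * _]mulrC.
Qed.

Lemma plane_path_lead U V W t : cpeval W != 0 ->
  size (plane_path U V W t) = d.+1 /\
  lead_coef (plane_path U V W t) = cpeval W.
Proof.
move=> W0; rewrite plane_pathE.
have [s c] := mmap_line_top hom_p rc (fun i => (U + rc t *: V) i 0)
  (fun i => W i 0).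
set q := mmap _ _ _ in s c *.
have sE : size q = d.+1.
  apply/eqP; rewrite eqn_leq s /= ltnNge; apply: contra W0 => s'.
  by rewrite /cpeval -c nth_default.
by split=> //; rewrite /lead_coef sE.
Qed.

Local Notation N := (@Normc.normc R).

Lemma horner_lip01 (P : {poly C}) : exists2 M : R, 0 <= M &
  forall t t' : R, 0 <= t <= 1 -> 0 <= t' <= 1 ->
    N (P.[rc t] - P.[rc t']) <= M * `|t - t'|.
Proof.
suff [M [M0 _ H]] : exists M : R, [/\ 0 <= M,
  forall t : R, 0 <= t <= 1 -> N P.[rc t] <= M &
  forall t t' : R, 0 <= t <= 1 -> 0 <= t' <= 1 ->
    N (P.[rc t] - P.[rc t']) <= M * `|t - t'|] by exists M.
elim/poly_ind: P => [|P c [M [M0 bM lM]]].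
  exists 0; split=> // [t _|t t' _ _]; rewrite !horner0 ?subrr ?mul0r.
    by rewrite Normc.normc0.
  by rewrite Normc.normc0.
have N01 (t : R) : 0 <= t <= 1 -> 0 <= N (rc t) <= 1.
  by move=> /andP[t0 t1]; rewrite normc_real ger0_norm// t0.
exists (2 * M + N c); split.
- by rewrite addr_ge0 ?mulr_ge0 ?normc_ge0.
- move=> t t01; rewrite hornerMXaddC (le_trans (normc_triangle _ _))// lerD2r normc_mul.
  have /andP[a b] := N01 t t01; have := bM t t01.
  have := normc_ge0 P.[rc t]; nra.
- move=> t t' t01 t'01; rewrite !hornerMXaddC.
  have -> : P.[rc t] * rc t + c - (P.[rc t'] * rc t' + c) =
    (P.[rc t] - P.[rc t']) * rc t + P.[rc t'] * rc (t - t').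
    by rewrite rmorphB /=; ring.
  rewrite (le_trans (normc_triangle _ _))// !normc_mul [N (rc (_ - _))]normc_real.
  have h1 : N (P.[rc t] - P.[rc t']) * N (rc t) <= M * `|t - t'|.
    have /andP[a b] := N01 t t01.
    by rewrite (le_trans _ (lM t t' t01 t'01))// ler_piMr ?normc_ge0.
  have h2 : N P.[rc t'] * `|t - t'| <= M * `|t - t'|.
    by rewrite ler_wpM2r// bM.
  have := mulr_ge0 (normc_ge0 c) (normr_ge0 (t - t')); lra.
Qed.

Lemma plane_path_lip U V W : exists2 M : R, 0 <= M &
  forall (t t' : R) j, 0 <= t <= 1 -> 0 <= t' <= 1 ->
    N ((plane_path U V W t)`_j - (plane_path U V W t')`_j) <= M * `|t - t'|.
Proof.
suff [M M0 H] : exists2 M : R, 0 <= M & forall (t t' : R) j,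
    (j < size (plane_poly U V W))%N -> 0 <= t <= 1 -> 0 <= t' <= 1 ->
    N (((plane_poly U V W)`_j).[rc t] - ((plane_poly U V W)`_j).[rc t'])
      <= M * `|t - t'|.
  exists M => // t t' j t01 t'01; rewrite /plane_path !coef_map /=.
  rewrite /horner_eval; have [jP|jP] := ltnP j (size (plane_poly U V W)).
    exact: H.
  by rewrite nth_default// !horner0 subrr Normc.normc0 mulr_ge0.
elim: (size _) => [|m [M M0 H]]; first by exists 0.
have [M' M'0 H'] := horner_lip01 ((plane_poly U V W)`_m).
exists (M + M') => [|t t' j jm t01 t'01]; first exact: addr_ge0.
rewrite mulrDl; have := normr_ge0 (t - t').
move: jm; rewrite ltnS leq_eqVlt => /orP[/eqP->|jm] a0.
  by rewrite ler_wpDl ?mulr_ge0// H'.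
by rewrite ler_wpDr ?mulr_ge0// H.
Qed.

Lemma cpeval_lower_path U V W : cpeval W != 0 ->
  (forall (t : R) z, 0 <= t <= 1 -> cpeval (U + rc t *: V + z *: W) = 0 ->
     complex.Im z != 0) ->
  (forall z, cpeval (U + z *: W) = 0 -> complex.Im z < 0) ->
  forall z, cpeval (U + V + z *: W) = 0 -> complex.Im z < 0.
Proof.
move=> W0 nreal low z z0; have [M M0 lip] := plane_path_lip U V W.
apply: (lower_roots_path (d := d) W0 _ _ M0 lip).
- by move=> t; have [] := plane_path_lead U V t W0.
- by move=> t; have [] := plane_path_lead U V t W0.
- by move=> t w t01 /rootP; rewrite horner_plane_path; apply: nreal.
- move=> w /rootP; rewrite horner_plane_path rmorph0 scale0r addr0.
  exact: low.
- by apply/rootP; rewrite horner_plane_path rmorph1 scale1r.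
Qed.

Lemma cpeval_upper_perturb U V W z : cpeval W != 0 ->
  cpeval (U + z *: W) = 0 -> 0 < complex.Im z ->
  exists (t : R) w, [/\ 0 < t, cpeval (U + rc t *: V + w *: W) = 0 &
    0 < complex.Im w].
Proof.
move=> W0 z0 Iz; have [M M0 lip] := plane_path_lip U V W.
have t01 : (0 : R) <= (0 : R) <= (1 : R) by rewrite lexx ler01.
have rz : root (plane_path U V W 0) z.
  by apply/rootP; rewrite horner_plane_path rmorph0 scale0r addr0.
have [] := upper_root_persists (d := d) W0 _ _ M0 lip t01 rz Iz.
- by move=> t; have [] := plane_path_lead U V t W0.
- by move=> t; have [] := plane_path_lead U V t W0.
move=> eps eps0 h; pose t := Num.min 1 (eps / 2).
have t0 : 0 < t by rewrite lt_min ltr01 divr_gt0.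
have t1 : t <= 1 by rewrite ge_min lexx.
have te : t < eps.
  by rewrite (@le_lt_trans _ _ (eps / 2)) ?ge_min ?lexx ?orbT//; lra.
have [||w] := h t; rewrite ?(ltW t0) ?t1//.
  by rewrite sub0r normrN gtr0_norm.
by move=> /rootP; rewrite horner_plane_path => wt Iw; exists t, w.
Qed.

End ComplexPoints.

(** * Hyperbolicity cones *)

Section Shift.
Variable R : realType.
Implicit Types (f : {poly R}).

Lemma derivn_comp_shift f (a : R) k :
  (f \Po ('X + a%:P))^`(k) = f^`(k) \Po ('X + a%:P).
Proof.
elim: k => [|k IH]; first by rewrite !derivn0.
by rewrite !derivnS IH deriv_comp derivD derivX derivC addr0 mulr1.
Qed.

Lemma derivn_comp_opp f k :
  (f \Po - 'X)^`(k) = (-1) ^+ k *: (f^`(k) \Po - 'X).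
Proof.
elim: k => [|k IH]; first by rewrite !derivn0 expr0 scale1r.
by rewrite !derivnS IH derivZ deriv_comp derivN derivX mulrN1 exprSr mulrN1
  scalerN scaleNr.
Qed.

End Shift.

Section Hyperbolic.
Variables (R : realType) (n d : nat) (p : mpoly n R) (e : 'cV[R]_n).
Hypothesis hyp : hyperbolic d p e.
Local Notation rc := (real_complex R).
Implicit Types (x y v w a b : 'cV[R]_n).

Let hom_p : mhomogeneous d p. Proof. by have [] := hyp. Qed.
Let pe_gt0 : 0 < peval p e. Proof. by have [] := hyp. Qed.
Let pe_neq0 : peval p e != 0. Proof. by rewrite gt_eqF. Qed.

(** The Taylor coefficients of p at x in the direction e; up to the factor i!,
    they are the derivatives of p along e. *)
Definition taylor i x : R := (line_poly p x e)`_i.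
Local Notation tc := taylor.

Lemma tc_dirderiv i x : tc i x = (i`!%:R)^-1 * peval (dirderiv i e p) x.
Proof.
rewrite dirderivE horner_coef0 coef_derivn addn0 ffactnn -[X in _ * X]mulr_natl.
by rewrite mulKf// pnatr_eq0 -lt0n fact_gt0.
Qed.

Definition tc_line i x v : {poly R} :=
  (i`!%:R)^-1 *: line_poly (dirderiv i e p) x v.

Lemma horner_tc_line i x v s : (tc_line i x v).[s] = tc i (x + s *: v).
Proof. by rewrite hornerZ line_polyE tc_dirderiv. Qed.

Lemma tc_gt_d i x : (d < i)%N -> tc i x = 0.
Proof.
by move=> di; rewrite /taylor nth_default// (leq_trans (line_poly_top hom_p x e).1).
Qed.

Lemma tc_d x : tc d x = peval p e.
Proof. by have [] := line_poly_top hom_p x e. Qed.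

Lemma tc0 x : tc 0 x = peval p x.
Proof. by rewrite /taylor -horner_coef0 line_polyE scale0r addr0. Qed.

Lemma size_line x : size (line_poly p x e) = d.+1.
Proof. by have [] := line_poly_lead hom_p x pe_neq0. Qed.

Lemma lead_line x : lead_coef (line_poly p x e) = peval p e.
Proof. by have [] := line_poly_lead hom_p x pe_neq0. Qed.

Lemma real_rooted_line x : real_rooted (line_poly p x e).
Proof.
move=> z /rootP z0; have [_ _ /(_ x (- z)) H] := hyp.
rewrite -[z]opprK rpredN; apply: H; apply/rootP; rewrite -z0 -!cpeval_line.
by rewrite -[- e]scaleN1r cvecZ rmorphN1 scaleN1r scaleNr scalerN opprK.
Qed.

Lemma line_poly_shift x s :
  line_poly p (x + s *: e) e = line_poly p x e \Po ('X + s%:P).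
Proof.
apply: poly_ext => t _; rewrite horner_comp !line_polyE hornerD hornerX hornerC.
by rewrite -addrA -scalerDl addrC [s + t]addrC addrC.
Qed.

Lemma line_poly_opp x :
  line_poly p (- x) e = (-1) ^+ d *: (line_poly p x e \Po - 'X).
Proof.
apply: poly_ext => t _; rewrite hornerZ horner_comp !line_polyE hornerN hornerX.
by rewrite -peval_homog// scaleN1r opprD scaleNr opprK.
Qed.

Lemma line_poly_dirderiv k x :
  line_poly (dirderiv k e p) x e = (line_poly p x e)^`(k).
Proof.
apply: poly_ext => t _; rewrite line_polyE dirderivE line_poly_shift.
rewrite derivn_comp_shift horner_comp hornerD hornerX hornerC.
by rewrite add0r.
Qed.

Lemma size_derivn_line k x : (k <= d)%N ->
  (size (line_poly p x e)^`(k) = (d - k).+1)%N.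
Proof.
move=> kd; apply/eqP; rewrite eqn_leq; apply/andP; split; last first.
  by apply: size_derivn_gt; rewrite size_line; lia.
apply/leq_sizeP => j jd; rewrite coef_derivn nth_default ?mul0rn//.
by rewrite size_line; lia.
Qed.

Lemma real_rooted_derivn_line x k : (k <= d)%N ->
  real_rooted (line_poly p x e)^`(k).
Proof.
by move=> kd; apply/real_rooted_derivn/real_rooted_line; rewrite size_line.
Qed.

(** The derivatives of p along e are hyperbolic too, so that membership in the
    cones can be read off from the signs of Taylor coefficients. *)
Lemma tc_ge0P k x : (k <= d)%N ->
  (forall s, 0 < s -> (line_poly p x e)^`(k).[s] != 0) <->
  (forall i, (k <= i)%N -> 0 <= tc i x).
Proof.
move=> kd; set f := (line_poly p x e)^`(k).
have fi i : f`_i = tc (k + i) x *+ (k + i) ^_ k by rewrite coef_derivn.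
have lf : 0 < lead_coef f.
  rewrite /lead_coef size_derivn_line//= fi subnKC// tc_d.
  by rewrite pmulrn_lgt0// ffact_gt0.
split=> [nf i ki|t0 s s0].
  have [] := real_rooted_coef_ge0 (@real_rooted_derivn_line x k kd) lf nf.
  move=> /(_ (i - k)%N) + _; rewrite fi subnKC//.
  by rewrite pmulrn_lge0// ffact_gt0.
rewrite gt_eqF// coef_ge0_horner_gt0// => i.
by rewrite fi mulrn_wge0// t0// leq_addr.
Qed.

Lemma derivative_coneP k x : (k <= d)%N ->
  derivative_cone k p e x <-> forall i, (k <= i)%N -> 0 <= tc i x.
Proof.
move=> kd; rewrite -tc_ge0P//.
have E t : root (line_poly (dirderiv k e p) (- x) e) t =
    root (line_poly p x e)^`(k) (- t).
  rewrite line_poly_dirderiv line_poly_opp derivnZ derivn_comp_opp.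
  by rewrite !rootZ ?signr_eq0// /root horner_comp hornerN hornerX.
split=> [H s s0|H t].
  apply/negP => fs; have := H (- s); rewrite E opprK => /(_ fs).
  by rewrite oppr_ge0 leNgt s0.
rewrite E leNgt => rt; apply/negP => t0.
by have := H (- t); rewrite oppr_gt0 => /(_ t0); rewrite -rootE rt.
Qed.

Lemma hconeP x : hcone p e x <-> forall i, 0 <= tc i x.
Proof.
have -> : hcone p e x <-> derivative_cone 0 p e x.
  by rewrite /derivative_cone /hcone /= line_poly_dirderiv.
by rewrite derivative_coneP//; split=> [H i|H i _]; apply: H.
Qed.

Lemma hcone_derivative k x : (k <= d)%N ->
  hcone p e x -> derivative_cone k p e x.
Proof. by move=> kd /hconeP xK; apply/derivative_coneP => // i _. Qed.

Lemma tc_gt0_up k x i j : (k <= i <= j)%N -> (j <= d)%N ->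
  (forall i, (k <= i)%N -> 0 <= tc i x) -> 0 < tc i x -> 0 < tc j x.
Proof.
move=> /andP[ki ij] jd x0 i0; have kd : (k <= d)%N by lia.
have nf := (tc_ge0P x kd).2 x0.
set f := (line_poly p x e)^`(k) in nf.
have fi i' : f`_i' = tc (k + i') x *+ (k + i') ^_ k by rewrite coef_derivn.
have lf : 0 < lead_coef f.
  rewrite /lead_coef size_derivn_line//= fi subnKC// tc_d.
  by rewrite pmulrn_lgt0// ffact_gt0.
have [_] := real_rooted_coef_ge0 (@real_rooted_derivn_line x k kd) lf nf.
move=> /(_ (i - k)%N (j - k)%N); rewrite !fi !subnKC ?(leq_trans ki)//.
rewrite !pmulrn_lgt0 ?ffact_gt0 ?(leq_trans ki)//; apply => //.
by rewrite size_derivn_line//; lia.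
Qed.

(** A vanishing c_(k+1) on the derivative cone forces c_k to vanish, and two
    consecutive vanishing coefficients of a real-rooted polynomial force all the
    lower ones to vanish. *)
Lemma derivative_cone_mult2 k x : (k < d)%N ->
  (forall i, (k <= i)%N -> 0 <= tc i x) -> tc k.+1 x = 0 -> hcone p e x.
Proof.
move=> kd x0 x1; have xk : tc k x = 0.
  apply/eqP; rewrite eq_le (x0 k (leqnn k)) andbT leNgt; apply/negP => H.
  have := @tc_gt0_up k x k k.+1; rewrite leqnn leqnSn x1 ltxx => /(_ isT kd x0 H).
  by [].
apply/hconeP => i; have [ik|/ltnW] := leqP i k; last exact: x0.
suff -> : tc i x = 0 by [].
by apply: (real_rooted_coef_gap (@real_rooted_line x) _ xk x1 ik); rewrite size_line.
Qed.

(** ** The open cone *)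

(** The interior of the cone in terms of the values of p: by hyperbolicity, p is
    positive on the ray from x in the direction e if and only if all Taylor
    coefficients at x are. *)
Definition int_cone x : Prop := forall s, 0 <= s -> 0 < peval p (x + s *: e).

Lemma int_coneP x : int_cone x <-> forall i, (i <= d)%N -> 0 < tc i x.
Proof.
have lf : 0 < lead_coef (line_poly p x e) by rewrite lead_line.
split=> [xi i id_|x0 s s0].
  have nf s : 0 < s -> (line_poly p x e).[s] != 0.
    by move=> /ltW /xi h; rewrite line_polyE gt_eqF.
  have [_] := real_rooted_coef_ge0 (@real_rooted_line x) lf nf.
  move=> /(_ 0%N i); rewrite leq0n size_line ltnS => /(_ id_); apply.
  rewrite -[_`_0]/(tc 0 x) tc0; have := xi 0 (lexx 0).
  by rewrite scale0r addr0.
move: s0; rewrite le_eqVlt => /orP[/eqP<-|s0].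
  by rewrite scale0r addr0 -tc0 x0.
rewrite -line_polyE coef_ge0_horner_gt0// => i.
have [id_|/tc_gt_d] := leqP i d; first exact/ltW/x0.
by rewrite /taylor => ->.
Qed.

Lemma int_hcone x : int_cone x -> hcone p e x.
Proof.
move=> /int_coneP xi; apply/hconeP => i.
by have [/xi/ltW//|/tc_gt_d->] := leqP i d.
Qed.

Lemma hcone_int x s : hcone p e x -> 0 < s -> int_cone (x + s *: e).
Proof.
move=> /hconeP xK s0 t t0; rewrite -addrA -scalerDl -line_polyE.
by rewrite coef_ge0_horner_gt0 ?lead_line// ltr_wpDr.
Qed.

Lemma int_hcone_closed x :
  (forall s, 0 < s -> int_cone (x + s *: e)) -> hcone p e x.
Proof.
move=> xi; apply/hconeP => i.
have -> : tc i x = (tc_line i x e).[0] by rewrite horner_tc_line scale0r addr0.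
apply: (horner0_ge0 ltr01) => s s0 _; rewrite horner_tc_line.
by have /hconeP := int_hcone (xi s s0).
Qed.

Lemma int_cone_e : int_cone e.
Proof.
move=> s s0; rewrite -[X in X + _]scale1r -scalerDl (peval_homog hom_p).
by rewrite mulr_gt0// exprn_gt0// ltr_pwDl.
Qed.

Lemma int_coneZ c x : 0 < c -> int_cone x -> int_cone (c *: x).
Proof.
move=> c0 xi s s0; have -> : s *: e = c *: ((s / c) *: e).
  by rewrite scalerA mulrC divfK// gt_eqF.
by rewrite -scalerDr (peval_homog hom_p) mulr_gt0 ?exprn_gt0// xi// divr_ge0// ltW.
Qed.

Lemma hconeZ c x : 0 <= c -> hcone p e x -> hcone p e (c *: x).
Proof.
rewrite le_eqVlt => /orP[/eqP<- _|c0 xK].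
  rewrite scale0r; apply: int_hcone_closed => s s0; rewrite add0r.
  exact: int_coneZ int_cone_e.
apply: int_hcone_closed => s s0; have -> : s *: e = c *: ((s / c) *: e).
  by rewrite scalerA mulrC divfK// gt_eqF.
by rewrite -scalerDr; apply: int_coneZ => //; apply: hcone_int => //; apply: divr_gt0.
Qed.

(** ** Hyperbolicity along all interior directions *)

(** For a in the open cone, the polynomial z |-> p(y + i t e + z a) never has a
    real root, because p is hyperbolic along e. Its roots lie in the lower half
    plane for y = 0, hence, moving y along a segment, for every y. *)
Lemma lower_half_plane a y t z : int_cone a -> 0 < t ->
  cpeval p (cvec y + (rc t * 'i%C) *: cvec e + z *: cvec a) = 0 ->
  complex.Im z < 0.
Proof.
move=> ai t0; rewrite [cvec y + _]addrC.
have pa : 0 < peval p a by have := ai 0 (lexx 0); rewrite scale0r addr0.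
have tiE : rc t * 'i%C = (0 +i* t)%C by simpc.
apply: (cpeval_lower_path hom_p); first by rewrite cpeval_cvec fmorph_eq0 gt_eqF.
  move=> s w _ w0; apply/negP => /eqP Iw.
  have wE : w = rc (complex.Re w) by case: w Iw {w0} => u v /= ->.
  move: w0; rewrite wE -!cvecZ -addrA -cvecD addrC cpeval_line => /rootP.
  move=> /real_rooted_line /complex_realP[r]; rewrite tiE => -[_ t00].
  by rewrite t00 ltxx in t0.
move=> w; have [->|w0] := eqVneq w 0.
  rewrite scale0r addr0 (cpeval_homog hom_p) cpeval_cvec => /eqP.
  rewrite mulf_eq0 fmorph_eq0 (negbTE pe_neq0) orbF expf_eq0 tiE eq_complex /=.
  by rewrite (gt_eqF t0) !andbF.
have -> : (rc t * 'i%C) *: cvec e + w *: cvec a =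
    w *: (cvec a + (rc t * 'i%C / w) *: cvec e).
  by rewrite scalerDr scalerA [w * _]mulrC divfK// addrC.
rewrite (cpeval_homog hom_p) cpeval_line => /eqP.
rewrite mulf_eq0 expf_eq0 (negbTE w0) andbF /= => /eqP/rootP rw.
have /complex_realP[r rE] := real_rooted_line rw.
move: rw; rewrite rE /root horner_map fmorph_eq0 line_polyE => /eqP pr.
have r0 : r < 0.
  by rewrite ltNge; apply/negP => /ai; rewrite pr ltxx.
have : rc t * 'i%C = rc r * w by rewrite -rE divfK.
rewrite tiE; case: w {w0 rE} => u v; simpc => -[_ tE].
rewrite ltNge; apply/negP => v0; move: t0; rewrite tE ltNge => /negP; apply.
by rewrite mulr_le0_ge0// ltW.
Qed.

(** Letting t tend to 0 in the previous lemma, a root in the upper half plane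
    would persist; a root in the lower one is excluded by conjugation. *)
Lemma real_rooted_int a y : int_cone a -> real_rooted (line_poly p y a).
Proof.
move=> ai.
have pa : 0 < peval p a by have := ai 0 (lexx 0); rewrite scale0r addr0.
have up z : root (map_poly rc (line_poly p y a)) z -> complex.Im z <= 0.
  move=> /rootP; rewrite -cpeval_line => z0; rewrite leNgt; apply/negP => Iz.
  have pa0 : cpeval p (cvec a) != 0 by rewrite cpeval_cvec fmorph_eq0 gt_eqF.
  have [t [w [t0 w0]]] :=
    cpeval_upper_perturb hom_p ('i%C *: cvec e) pa0 z0 Iz.
  move: w0; rewrite scalerA => w0.
  by apply/negP; rewrite -leNgt ltW// (lower_half_plane ai t0 w0).
move=> z rz; have Iz := up z rz.
have /up : root (map_poly rc (line_poly p y a)) z^*%C.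
  move: rz; rewrite -(fmorph_root conjc) -map_poly_comp.
  congr (is_true (root _ _)); apply: eq_map_poly => x /=.
  by rewrite /= oppr0.
move=> Iz'; apply/complex_realP; exists (complex.Re z).
case: z Iz Iz' {rz} => u v /= v0; rewrite oppr_le0 => v0'.
by congr (_ +i* _)%C; apply: le_anti; rewrite v0.
Qed.

Lemma int_cone_segment b t : int_cone b -> 0 <= t <= 1 ->
  0 < peval p (e + t *: (b - e)).
Proof.
move=> bi /andP[]; rewrite le_eqVlt => /orP[/eqP<- _|t0 t1].
  by rewrite scale0r addr0.
have -> : e + t *: (b - e) = t *: (b + ((1 - t) / t) *: e).
  rewrite !scalerDr scalerA mulrC divfK ?gt_eqF// scalerBl scale1r scalerN.
  by rewrite addrCA.
rewrite (peval_homog hom_p) mulr_gt0 ?exprn_gt0// bi// divr_ge0 ?subr_ge0//.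
exact: ltW.
Qed.

(** Gårding's theorem. The roots of z |-> p(b + z a) are real, and they do not
    cross 0 when b moves along the segment from e, where they are negative. *)
Lemma line_poly_int_gt0 a b : int_cone a -> int_cone b ->
  forall i, (i <= d)%N -> 0 < (line_poly p b a)`_i.
Proof.
move=> ai bi.
have pa : 0 < peval p a by have := ai 0 (lexx 0); rewrite scale0r addr0.
have pa0 : peval p a != 0 by rewrite gt_eqF.
(* Multiplication by - i maps the lower half plane to the left one, so that the
   negative real roots can be followed by [cpeval_lower_path]. *)
have iE (z : R[i]) : complex.Re (z * - 'i%C) = complex.Im z.
  by case: z => u v; simpc.
have real y z : cpeval p (cvec y + z *: (- 'i%C *: cvec a)) = 0 ->
    exists2 u, peval p (y + u *: a) = 0 & complex.Im z = u.
  rewrite scalerA cpeval_line => /rootP rz.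
  have /complex_realP[u uE] := real_rooted_int ai rz.
  exists u; last by rewrite -iE uE.
  move: rz; rewrite uE /root horner_map fmorph_eq0 line_polyE.
  by move/eqP.
have low z : cpeval p (cvec b + z *: (- 'i%C *: cvec a)) = 0 ->
    complex.Im z < 0.
  have -> : cvec b = cvec e + (cvec (b - e)) by rewrite -cvecD addrC subrK.
  apply: (cpeval_lower_path hom_p).
  - rewrite (cpeval_homog hom_p) cpeval_cvec mulf_neq0 ?fmorph_eq0//.
    by rewrite expf_neq0// oppr_eq0 eq_complex /= oner_eq0 andbF.
  - move=> t w t01; rewrite -cvecZ -cvecD => /real[u pu ->].
    apply/eqP => u0; move: pu; rewrite u0 scale0r addr0 => /eqP.
    by rewrite gt_eqF// int_cone_segment.
  - move=> w /real[u pu ->]; rewrite ltNge le_eqVlt; apply/negP.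
    move=> /orP[/eqP u0|u0]; move: pu.
      by rewrite -u0 scale0r addr0 => /eqP; rewrite gt_eqF.
    have -> : e + u *: a = u *: (a + u^-1 *: e).
      by rewrite scalerDr scalerA divff ?gt_eqF// scale1r addrC.
    rewrite (peval_homog hom_p) => /eqP; rewrite gt_eqF//.
    by rewrite mulr_gt0 ?exprn_gt0// ai// invr_ge0 ltW.
have [sf lf] := line_poly_lead hom_p b pa0.
have nf s : 0 < s -> (line_poly p b a).[s] != 0.
  move=> s0; rewrite line_polyE; apply/negP => /eqP ps.
  have /low : cpeval p (cvec b + (rc s * 'i%C) *: (- 'i%C *: cvec a)) = 0.
    have -> : (rc s * 'i%C) *: (- 'i%C *: cvec a) = cvec (s *: a).
      rewrite scalerA cvecZ; congr (_ *: _); by simpc.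
    by rewrite -cvecD cpeval_cvec ps rmorph0.
  by simpc => /= /lt_gtF; rewrite s0.
move=> i id_.
have [|_ ] := real_rooted_coef_ge0 (real_rooted_int ai (y := b)) _ nf.
  by rewrite lf.
move=> /(_ 0%N i); rewrite leq0n sf ltnS => /(_ id_); apply.
have := bi 0 (lexx 0); rewrite scale0r addr0 -horner_coef0 line_polyE.
by rewrite scale0r addr0.
Qed.

Lemma int_coneD a b : int_cone a -> int_cone b -> int_cone (b + a).
Proof.
move=> ai bi s s0; rewrite -addrA [a + _]addrC addrA.
have bi' : int_cone (b + s *: e).
  by move=> t t0; rewrite -addrA -scalerDl bi// addr_ge0.
rewrite -[a in X in peval p X]scale1r -line_polyE.
apply: coef_ge0_horner_gt0 => // [i|].
  have [id_|di] := leqP i d; first exact/ltW/line_poly_int_gt0.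
  by rewrite nth_default// (leq_trans (line_poly_top hom_p _ _).1).
have pa : 0 < peval p a by have := ai 0 (lexx 0); rewrite scale0r addr0.
by have [_ ->] := line_poly_lead hom_p (b + s *: e) (lt0r_neq0 pa).
Qed.

Lemma hconeD x y : hcone p e x -> hcone p e y -> hcone p e (x + y).
Proof.
move=> xK yK; apply: int_hcone_closed => s s0.
have -> : x + y + s *: e = (x + (s / 2) *: e) + (y + (s / 2) *: e).
  by rewrite addrACA -scalerDl -splitr.
by apply: int_coneD; apply: hcone_int => //; apply: divr_gt0.
Qed.

Lemma peval_ge0 x : hcone p e x -> 0 <= peval p x.
Proof. by move=> /hconeP; rewrite -tc0. Qed.

(** If x and w lie in the open cone then p(x + t w) has positive coefficients in
    t. In general, add s e to both and let s tend to 0. *)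
Lemma peval_mono x w : hcone p e x -> hcone p e w ->
  peval p x <= peval p (x + w).
Proof.
move=> xK wK; rewrite -subr_ge0.
have : 0 <= (line_poly p (x + w) (2 *: e) - line_poly p x e).[0].
  apply: (horner0_ge0 ltr01) => s s0 _.
  rewrite hornerD hornerN !line_polyE subr_ge0.
  have xi := hcone_int xK s0; have wi := hcone_int wK s0.
  have -> : x + w + s *: (2 *: e) = (x + s *: e) + 1 *: (w + s *: e).
    by rewrite scalerA mulr2n mulrDr mulr1 scalerDl scale1r addrACA.
  have l0 := line_poly_int_gt0 wi xi.
  rewrite -[X in _ <= X]line_polyE horner_coef.
  have -> : peval p (x + s *: e) =
      (line_poly p (x + s *: e) (w + s *: e))`_0.
    by rewrite -horner_coef0 line_polyE scale0r addr0.
  have pw : 0 < peval p (w + s *: e).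
    by have := wi 0 (lexx 0); rewrite scale0r addr0.
  have [-> _] := line_poly_lead hom_p (x + s *: e) (lt0r_neq0 pw).
  rewrite big_ord_recl expr0 mulr1 lerDl sumr_ge0// => i _.
  by rewrite expr1n mulr1 ltW// l0// ltn_ord.
by rewrite hornerD hornerN !line_polyE !scale0r !addr0.
Qed.

End Hyperbolic.

(** * Interior points *)

Lemma peval_continuous (R : realType) n (q : mpoly n R) (x : 'cV[R]_n) :
  (fun y => peval q y) @ x --> (peval q x : R).
Proof.
have F : Filter (nbhs x) := nbhs_filter x.
have cst (a : R) : (fun=> a) @ x --> a by exact: (@cvg_cst R a _ (nbhs x) F).
have cX i k : (fun y : 'cV[R]_n => y i 0 ^+ k) @ x --> (x i 0 ^+ k : R).
  elim: k => [|k IH].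
    by rewrite expr0; under eq_fun do rewrite expr0; exact: cst.
  rewrite exprS; under eq_fun do rewrite exprS.
  by apply: cvgM => //; exact: coord_continuous.
rewrite /peval mevalE; under eq_fun do rewrite mevalE.
apply: (cvg_big (U := R)) => [|m _]; first exact: add_continuous.
apply: cvgM; first exact: cst.
by apply: (cvg_big (U := R)) => [|i _]; first exact: mul_continuous.
Qed.

Lemma peval_near (R : realType) n (q : mpoly n R) (x : 'cV[R]_n) : 0 < peval q x ->
  \forall y \near nbhs x, 0 < peval q y.
Proof.
move=> h. exact: (cvgr_gt _ (@peval_continuous _ _ q x) _ h).
Qed.

Section NearCone.
Variables (R : realType) (n d : nat) (p : mpoly n R) (e : 'cV[R]_n).
Hypothesis hyp : hyperbolic d p e.
Implicit Types (x v : 'cV[R]_n).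
Local Notation tc := (taylor p e).

Let hom_p : mhomogeneous d p. Proof. by have [] := hyp. Qed.

(** Positivity of finitely many polynomials is an open condition. *)
Lemma relint_derivative_cone k x : (k <= d)%N ->
  (forall i, (k <= i <= d)%N -> 0 < tc i x) ->
  relint (derivative_cone k p e) x.
Proof.
move=> kd x0.
have cone_of y : (forall i, (k <= i <= d)%N -> 0 < tc i y) ->
    derivative_cone k p e y.
  move=> y0; apply/(derivative_coneP hyp y kd) => i ki.
  have [id_|di] := leqP i d; first by rewrite ltW// y0// ki.
  by rewrite (tc_gt_d hyp y di).
split; first exact: cone_of.
apply: cvg_within; suff H m : \forall y \near nbhs x,
    forall i, (i < m)%N -> (k <= i <= d)%N -> 0 < tc i y.
  have := H d.+1; apply: filterS => y y0; apply: cone_of => i /andP[ki id_].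
  by apply: y0 => //; apply/andP.
elim: m => [|m IH]; first exact: nearW.
have [/andP[km md]|kmd] := boolP (k <= m <= d)%N; last first.
  apply: filterS IH => y y0 i; rewrite ltnS leq_eqVlt => /orP[/eqP->|].
    by rewrite (negbTE kmd).
  exact: y0.
have fpos : 0 < (m`!%:R : R)^-1 by rewrite invr_gt0 ltr0n fact_gt0.
have := x0 m; rewrite km md tc_dirderiv pmulr_rgt0// => /(_ isT) qx.
apply: filterS2 IH (peval_near qx) => y y0 qy i.
rewrite ltnS leq_eqVlt => /orP[/eqP-> _|]; last exact: y0.
by rewrite tc_dirderiv mulr_gt0.
Qed.

Lemma tc_gt0_near_line k x v :
  (forall i, (k <= i <= d)%N -> 0 < tc i x) ->
  exists2 del : R, 0 < del & forall s, `|s| < del ->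
    forall i, (k <= i <= d)%N -> 0 < tc i (x + s *: v).
Proof.
move=> x0; suff H m : exists2 del : R, 0 < del & forall s, `|s| < del ->
    forall i, (i < m)%N -> (k <= i <= d)%N -> 0 < tc i (x + s *: v).
  have [del del0 h] := H d.+1; exists del => // s sd i kid.
  by apply: h => //; case/andP: kid.
elim: m => [|m [del del0 h]]; first by exists 1.
have [kmd|kmd] := boolP (k <= m <= d)%N; last first.
  exists del => // s sd i; rewrite ltnS leq_eqVlt => /orP[/eqP->|].
    by rewrite (negbTE kmd).
  exact: h.
have [|del' del'0 h'] := @horner_gt0_near0 _ (tc_line p e m x v).
  by rewrite horner_tc_line scale0r addr0 x0.
exists (Num.min del del'); first by rewrite lt_min del0.
move=> s; rewrite lt_min => /andP[sd sd'] i; rewrite ltnS leq_eqVlt.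
move=> /orP[/eqP-> _|]; last exact: h.
by rewrite -horner_tc_line h'.
Qed.

Lemma int_cone_near_line x v : int_cone p e x ->
  exists2 del : R, 0 < del & forall s, `|s| < del -> int_cone p e (x + s *: v).
Proof.
move=> /(int_coneP hyp) xi.
have [|del del0 h] := @tc_gt0_near_line 0 x v; first by move=> i /xi.
by exists del => // s sd; apply/(int_coneP hyp) => i id_; apply: h.
Qed.

(** ** Homogeneity of the Taylor coefficients *)

Lemma coef_comp_scaleX (f : {poly R}) a i : (f \Po (a *: 'X))`_i = a ^+ i * f`_i.
Proof.
elim/poly_ind: f i => [|f c IH] i; first by rewrite comp_poly0 !coef0 mulr0.
rewrite comp_poly_MXaddC !coefD !coefC -scalerAr coefZ !coefMX.
case: i => [|i] /=; first by rewrite mulr0 !add0r expr0 mul1r.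
by rewrite !addr0 IH mulrA exprS.
Qed.

Lemma tc_homog a x i : a ^+ i * tc i (a *: x) = a ^+ d * tc i x.
Proof.
rewrite /taylor -coef_comp_scaleX -coefZ.
suff -> : line_poly p (a *: x) e \Po (a *: 'X) = a ^+ d *: line_poly p x e by [].
apply: poly_ext => s _; rewrite hornerZ horner_comp hornerZ hornerX !line_polyE.
by rewrite -(peval_homog hom_p) scalerDr scalerA.
Qed.

Lemma tc_homogV a x i : a != 0 -> (i <= d)%N ->
  tc i (a *: x) = a ^+ (d - i) * tc i x.
Proof.
move=> a0 id_; apply: (mulfI (expf_neq0 i a0)).
by rewrite tc_homog mulrA -exprD subnKC.
Qed.

Lemma tc_opp_eq0 x i : tc i x = 0 -> tc i (- x) = 0.
Proof.
move=> xi; have := tc_homog (-1) x i; rewrite xi mulr0 scaleN1r => /eqP.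
by rewrite mulf_eq0 signr_eq0 => /eqP.
Qed.

(** ** Vectors of rank at most one *)

(** For a vector x of the cone, this says that its rank is at most one. *)
Definition affine_along x : Prop := forall b t,
  peval p (b + t *: x) = peval p b + t * (peval p (b + x) - peval p b).

(** Near e, monotonicity bounds the nonnegative polynomial t |-> p(b + t x) by
    t |-> p(2 e + t x), which has degree 1 since x has rank at most one. The
    conclusion extends from a neighborhood of e to all points since both sides
    are polynomial along lines through e. *)
Lemma low_rank_affine x : (0 < d)%N -> hcone p e x ->
  (forall i, (i < d.-1)%N -> tc i x = 0) -> affine_along x.
Proof.
move=> d0 xK x0 b t.
have lx s : (line_poly p x e).[s] = tc d.-1 x * s ^+ d.-1 + tc d x * s ^+ d.
  rewrite horner_coef (size_line hyp) -(prednK d0) !big_ord_recr /= big1 ?add0r//.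
  by move=> i _; rewrite -[_`_i]/(tc i x) x0// mul0r.
have two_e : exists al be : R, forall s, 0 < s ->
    peval p (2 *: e + s *: x) = al + be * s.
  exists (tc d x * 2 ^+ d), (tc d.-1 x * 2 ^+ d.-1) => s s0.
  have -> : 2 *: e + s *: x = s *: (x + (2 / s) *: e).
    by rewrite scalerDr scalerA [s * _]mulrC divfK ?gt_eqF// addrC.
  rewrite (peval_homog hom_p) -line_polyE lx mulrDr addrC; congr (_ + _).
    by rewrite mulrCA -exprMn [s * _]mulrC divfK ?gt_eqF.
  rewrite mulrCA -[in s ^+ d](prednK d0) exprS -[s * _ * _]mulrA -exprMn.
  by rewrite [s * (2 / s)]mulrC divfK ?gt_eqF// [s * _]mulrC mulrA.
have [al [be ab]] := two_e.
have [del del0 near_e] := int_cone_near_line (b - e) (int_cone_e hyp).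
pose E (c : 'cV[R]_n) := peval p (c + t *: x) -
  (peval p c + t * (peval p (c + x) - peval p c)).
suff /eqP : E b = 0 by rewrite subr_eq0 => /eqP.
pose F := line_poly p (e + t *: x) (b - e) - (line_poly p e (b - e) +
  t *: (line_poly p (e + x) (b - e) - line_poly p e (b - e))).
have FE s : F.[s] = E (e + s *: (b - e)).
  rewrite /F /E !(hornerD, hornerN, hornerZ) !line_polyE.
  by rewrite (addrAC e (t *: x)) (addrAC e x).
have -> : E b = F.[1] by rewrite FE scale1r addrC subrK.
suff -> : F = 0 by rewrite horner0.
apply: (poly_eq0_itv del0) => s s0 sd; rewrite FE.
set c := e + s *: (b - e).
have cK : hcone p e c.
  by apply: (int_hcone hyp); apply: near_e; rewrite gtr0_norm.
have cK' : hcone p e (2 *: e - c).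
  have -> : 2 *: e - c = e + (- s) *: (b - e).
    by rewrite /c mulr2n scalerDl scale1r opprD addrA addrK scaleNr.
  by apply: (int_hcone hyp); apply: near_e; rewrite normrN gtr0_norm.
have sz : (size (line_poly p c x) <= 2)%N.
  apply: (@size_le2_bounded _ _ al be) => r r0; rewrite line_polyE.
  have rxK := hconeZ hyp (ltW r0) xK.
  have crK := hconeD hyp cK rxK.
  rewrite (peval_ge0 hyp crK) /= -ab//.
  have -> : 2 *: e + r *: x = c + r *: x + (2 *: e - c).
    by rewrite addrC [c + _]addrC -addrA [c + _]addrC subrK.
  exact: (peval_mono hyp).
have lin r : peval p (c + r *: x) =
    (line_poly p c x)`_0 + (line_poly p c x)`_1 * r.
  rewrite -line_polyE (horner_coef_wide _ sz) !big_ord_recl big_ord0 /=.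
  by rewrite expr0 mulr1 addr0 expr1.
have lin0 := lin 0; rewrite scale0r addr0 mulr0 addr0 in lin0.
have lin1 := lin 1; rewrite scale1r mulr1 in lin1.
by rewrite /E lin lin0 lin1; ring.
Qed.

Lemma count_rootsR (q : {poly R}) rs : q != 0 ->
  q = lead_coef q *: \prod_(r <- rs) ('X - r%:P) ->
  (\sum_(t <- rootsR q | t != 0%R) mup t q)%N = count (fun r => r != 0) rs.
Proof.
move=> q0 qE; have c0 : lead_coef q != 0 by rewrite lead_coef_eq0.
have mupE t : mup t q = (\sum_(r <- rs) (r == t))%N.
  rewrite qE -mul_polyC mupMr ?rootC// mu_prod_XsubC -sum1_count big_mkcond.
  by apply: eq_bigr => r _ /=; case: (_ == _).
under eq_bigr do rewrite mupE.
rewrite exchange_big /= -sum1_count [RHS]big_mkcond [LHS]big_seq [RHS]big_seq.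
apply: eq_bigr => r rrs.
have rR : r \in rootsR q.
  rewrite -(roots_on_rootsR q0) in_itv /= qE rootZ//.
  by rewrite root_prod_XsubC.
have [->|r0] /= := eqVneq r 0.
  by apply: big1 => t; rewrite eq_sym => /negbTE->.
rewrite big_mkcond (bigD1_seq r) ?uniq_roots//= r0 eqxx big1 ?addn0// => t tr.
by rewrite [r == t]eq_sym (negbTE tr) if_same.
Qed.

(** Of the d real roots of t |-> p(t e - x), exactly one is nonzero, so that
    t^(d-1) divides this polynomial. *)
Lemma hrank1_tc x i : hrank p e x = 1%N -> (i < d.-1)%N -> tc i x = 0.
Proof.
move=> rk id_; rewrite -[x]opprK; apply: tc_opp_eq0.
have [rs qE] := real_rooted_split (@real_rooted_line _ _ _ _ _ hyp (- x)).
have sq := size_line hyp (- x).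
rewrite /taylor; set q := line_poly p (- x) e in rk qE sq *.
have q0 : q != 0 by rewrite -size_poly_eq0 sq.
have c0 : lead_coef q != 0 by rewrite lead_coef_eq0.
have srs : size rs = d.
  by apply/eqP; rewrite -eqSS -sq qE size_scale// size_prod_XsubC.
have cnt : count (fun r => r == 0) rs = d.-1.
  have := count_predC (fun r => r == 0) rs; rewrite srs.
  by rewrite -(count_rootsR q0 qE) -/(hrank p e x) rk; lia.
rewrite qE coefZ (bigID (fun r => r == 0)) /=.
rewrite (eq_bigr (fun=> 'X)); last by move=> r /eqP->; rewrite subr0.
by rewrite big_const_seq iter_mulr_1 [count _ _]cnt coefXnM id_ mulr0.
Qed.

End NearCone.

(** * Decomposition into vectors of rank at most one *)

Section Decomposition.
Variables (R : realType) (n d : nat) (p : mpoly n R) (e : 'cV[R]_n).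
Hypothesis hyp : hyperbolic d p e.
Hypothesis d_gt0 : (0 < d)%N.
Implicit Types (x y u h w : 'cV[R]_n).
Local Notation tc := (taylor p e).
Local Notation K := (hcone p e).

Let hom_p : mhomogeneous d p. Proof. by have [] := hyp. Qed.
Let KD := hconeD hyp.
Let KZ := hconeZ hyp.
Let KP x : K x <-> forall i, 0 <= tc i x. Proof. exact: hconeP hyp x. Qed.

Lemma hcone0 : K 0.
Proof.
rewrite -(scale0r e); apply: KZ => //.
exact: (int_hcone hyp (int_cone_e hyp)).
Qed.

Lemma hcone_sum (I : eqType) (s : seq I) (E : I -> 'cV[R]_n) :
  (forall i, i \in s -> K (E i)) -> K (\sum_(i <- s) E i).
Proof.
move=> sK; rewrite big_seq; apply: big_ind => //; first exact: hcone0.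
Qed.

Lemma hcone_limit x w : (forall s, 0 < s -> s < 1 -> K (x + s *: w)) -> K x.
Proof.
move=> xw; apply/KP => i.
have -> : tc i x = (tc_line p e i x w).[0] by rewrite horner_tc_line scale0r addr0.
apply: (horner0_ge0 ltr01) => s s0 s1; rewrite horner_tc_line.
by have /KP := xw s s0 s1.
Qed.

(** By monotonicity p(u + s e) <= p(u + w + s e) for s > 0, so the polynomial on
    the left has at least the order at 0 of the one on the right. *)
Lemma tc_vanish_le u w m : K u -> K w -> (forall i, (i < m)%N -> tc i (u + w) = 0) ->
  forall i, (i < m)%N -> tc i u = 0.
Proof.
move=> uK wK uw0; apply: (coef_dominated ltr01 ((KP u).1 uK) _ uw0).
move=> s s0 _; rewrite !line_polyE addrAC; apply: (peval_mono hyp) => //.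
apply: KD => //; apply: KZ; first exact: ltW.
exact: (int_hcone hyp (int_cone_e hyp)).
Qed.

(** A segment of the cone along which the lowest m Taylor coefficients vanish
    extends beyond an end point where the other ones are positive: the vanishing
    ones are polynomials along the line, hence vanish on the whole line. *)
Lemma hcone_extend u h m : K u -> K h ->
  (forall i, (i < m)%N -> tc i (u + h) = 0) ->
  (forall i, (m <= i <= d)%N -> 0 < tc i u) ->
  exists2 eps, 0 < eps & K (u - eps *: h).
Proof.
move=> uK hK uh0 u0.
have line0 i s : (i < m)%N -> tc i (u + s *: h) = 0.
  move=> im; rewrite -horner_tc_line.
  suff -> : tc_line p e i u h = 0 by rewrite horner0.
  apply: (poly_eq0_itv ltr01) => r r0 r1; rewrite horner_tc_line.
  apply: (@tc_vanish_le _ ((1 - r) *: h) m _ _ _ i im).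
  - by apply: KD => //; apply: KZ => //; apply: ltW.
  - by apply: KZ => //; rewrite subr_ge0 ltW.
  - by move=> j jm; rewrite -addrA -scalerDl [r + _]addrC subrK scale1r uh0.
have [del del0 near] := tc_gt0_near_line h u0.
exists (del / 2); first by rewrite divr_gt0.
rewrite -scaleNr; apply/KP => i.
have [im|mi] := ltnP i m; first by rewrite line0.
have [id_|di] := leqP i d; last by rewrite (tc_gt_d hyp).
apply/ltW/near; last by rewrite mi.
by rewrite normrN gtr0_norm ?divr_gt0//; lra.
Qed.

Hypothesis K_pointed : pointed K.

Lemma pointed_eq0 x : K x -> K (- x) -> x = 0.
Proof.
move=> xK NxK; have : [set 0] x.
  by rewrite -K_pointed; split => //; exists (- x); rewrite ?opprK.
by [].
Qed.

Lemma tc_all0 x : (forall i, (i < d)%N -> tc i x = 0) -> x = 0.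
Proof.
have cone y : (forall i, (i < d)%N -> tc i y = 0) -> K y.
  move=> y0; apply/KP => i; have [/y0->//|] := ltnP i d.
  rewrite leq_eqVlt => /orP[/eqP<-|/(tc_gt_d hyp y)->//].
  by rewrite (tc_d hyp) ltW//; have [] := hyp.
move=> x0; apply: pointed_eq0; first exact: cone.
by apply: cone => i /x0; apply: (tc_opp_eq0 hyp).
Qed.

(** The half-line from x in the direction - y leaves the pointed closed cone; at
    the exit point it cannot be extended, so that by [hcone_extend] one more
    Taylor coefficient vanishes there. *)
Lemma hcone_exit x y m : K x -> K y -> K (x - y) -> y != 0 ->
  (forall i, (i < m)%N -> tc i x = 0) ->
  exists s, [/\ 0 <= s, K (x - s *: y) &
    forall i, (i <= m)%N -> (i <= d)%N -> tc i (x - s *: y) = 0].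
Proof.
move=> xK yK xyK y0 x0.
pose S : set R := fun s => K (x - s *: y).
have S1 : S 1 by rewrite /S scale1r.
have down s r : S s -> r <= s -> S r.
  move=> Ss rs; rewrite /S; have -> : x - r *: y = x - s *: y + (s - r) *: y.
    by rewrite scalerBl addrA subrK.
  by apply: KD => //; apply: KZ => //; rewrite subr_ge0.
have supS : has_sup S.
  split; first by exists 1.
  apply: contrapT => nub; move/eqP: y0; apply.
  rewrite -[y]opprK; suff -> : - y = 0 by rewrite oppr0.
  apply: pointed_eq0; last by rewrite opprK.
  apply: (@hcone_limit _ x) => s s0 _.
  have [r [Sr sr]] : exists r, S r /\ s^-1 < r.
    apply: contrapT => H; apply: nub; exists s^-1 => r Sr.
    by rewrite leNgt; apply/negP => h; apply: H; exists r.
  have := down _ _ Sr (ltW sr); rewrite /S => /(KZ (ltW s0)).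
  by rewrite scalerBr scalerA mulfV ?gt_eqF// scale1r addrC.
pose s := sup S.
have s1 : 1 <= s by apply: ub_le_sup => //; exact: supS.2.
have Ss : K (x - s *: y).
  apply: (@hcone_limit _ y) => r r0 _; rewrite -addrA -scaleNr -scalerDl.
  have [t St rt] := sup_adherent r0 supS.
  have := down t (s - r) St (ltW rt); rewrite /S -scaleNr opprB.
  by rewrite [r - s]addrC.
have x'0 i : (i < m)%N -> tc i (x - s *: y) = 0.
  apply: (tc_vanish_le Ss (w := s *: y)).
    by apply: KZ => //; apply: le_trans s1.
  by move=> j; rewrite subrK; apply: x0.
exists s; split=> //; first by apply: le_trans s1.
move=> i; rewrite leq_eqVlt => /orP[/eqP-> md|/x'0//].
apply/eqP; rewrite eq_le ((KP _).1 Ss) andbT leNgt; apply/negP => xm.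
have [||eps eps0] := @hcone_extend _ _ m Ss yK.
- move=> j jm; apply: (@tc_vanish_le _ ((s - 1) *: y) m) => //.
  + exact: KD.
  + by apply: KZ => //; rewrite subr_ge0.
  + by move=> l lm; rewrite scalerBl scale1r -addrA [y + _]addrC !subrK x0.
- move=> j /andP[mj jd]; apply: (tc_gt0_up hyp (k := 0) _ jd _ xm) => //.
  by move=> l _; apply: (KP _).1.
rewrite -addrA -opprD -scalerDl => /(ub_le_sup supS.2); rewrite -/s.
by rewrite gerDl leNgt eps0.
Qed.

(** The vector 0 is included, so that the notion is stable under multiplication
    by nonnegative scalars. *)
Definition rank_le1 x : Prop := K x /\ affine_along p x.

Definition rank_le1_sum x : Prop :=
  exists2 s : seq 'cV[R]_n, (forall y, y \in s -> rank_le1 y) & x = \sum_(y <- s) y.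

Lemma rank_le1Z a x : 0 <= a -> rank_le1 x -> rank_le1 (a *: x).
Proof.
move=> a0 [xK xa]; split; first exact: KZ.
by move=> b t; rewrite scalerA !xa; ring.
Qed.

Lemma rank_le1_sum1 x : rank_le1 x -> rank_le1_sum x.
Proof.
move=> xr; exists [:: x]; last by rewrite big_seq1.
by move=> y; rewrite inE => /eqP->.
Qed.

Lemma rank_le1_sumD x y : rank_le1_sum x -> rank_le1_sum y -> rank_le1_sum (x + y).
Proof.
move=> [s sr ->] [t tr ->]; exists (s ++ t); last by rewrite big_cat.
by move=> z; rewrite mem_cat => /orP[/sr|/tr].
Qed.

Lemma rank_le1_sumZ a x : 0 <= a -> rank_le1_sum x -> rank_le1_sum (a *: x).
Proof.
move=> a0 [s sr ->]; exists [seq a *: y | y <- s].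
  by move=> _ /mapP[y ys ->]; apply/rank_le1Z/sr.
by rewrite big_map scaler_sumr.
Qed.

Hypothesis rog : rank_one_generated p e.

Lemma rog_extreme x : x != 0 ->
  cone_face K [set a *: x | a in [set a : R | 0 <= a]] -> rank_le1 x.
Proof.
move=> x0 face; have [_ ext] := rog.
have [|x1 rk1 FE] := ext [set a *: x | a in [set a : R | 0 <= a]].
  split=> //; exists [tuple x]; split.
  - by rewrite free_cons span_nil memv0 x0 nil_free.
  - by move=> v; rewrite inE => /eqP->; exists 1; rewrite ?scale1r//= ler01.
  - by move=> v [a _ <-]; rewrite span_seq1 memvZ// memv_line.
have /= [a a0 xE] : [set a *: x1 | a in [set a : R | 0 <= a]] x.
  by rewrite -FE; exists 1; rewrite ?scale1r//= ler01.
rewrite -xE; apply: rank_le1Z => //.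
have x1K : K x1.
  have [_ _ FK _] := face; apply: FK; rewrite FE.
  by exists 1; rewrite ?scale1r//= ler01.
split=> //; apply: (low_rank_affine hyp) => // i.
exact: (hrank1_tc hyp).
Qed.

(** A vector x of the cone that does not span an extreme ray dominates a vector
    of the cone that is not a multiple of x; subtracting x from it, up to the
    boundary if needed, increases the multiplicity. *)
Lemma not_extreme_below x m : K x -> x != 0 ->
  (forall i, (i < m)%N -> tc i x = 0) -> (m <= d)%N ->
  ~ cone_face K [set a *: x | a in [set a : R | 0 <= a]] ->
  exists y, [/\ K y, K (x - y), y != 0 & forall i, (i <= m)%N -> tc i y = 0].
Proof.
set F := [set a *: x | a in _] => xK x0 tx0 md nface.
have F_pos a : 0 <= a -> F (a *: x) by move=> a0; exists a.
have [u [w [uK wK Fuw nFu]]] : exists u w, [/\ K u, K w, F (u + w) & ~ F u].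
  apply: contrapT => nex; apply: nface; split.
  - by exists x; rewrite -[x in F x]scale1r; apply: F_pos.
  - split=> [_ _ [a a0 <-] [b b0 <-]|c _ c0 [a a0 <-]].
      by rewrite -scalerDl; apply/F_pos/addr_ge0.
    by rewrite scalerA; apply/F_pos/mulr_ge0.
  - by move=> _ [a a0 <-]; apply: KZ.
  - move=> u w uK wK Fuw; split; apply: contrapT => nF; apply: nex.
      by exists u, w.
    by exists w, u; split=> //; rewrite addrC.
case: Fuw => a a0 auw.
have {}a0 : 0 < a.
  rewrite lt0r a0 andbT; apply/eqP => a00; move: auw.
  rewrite a00 scale0r => /esym/eqP; rewrite addr_eq0 => /eqP uw.
  apply: nFu; have -> : u = 0 by apply: pointed_eq0; rewrite // uw opprK.
  by rewrite -(scale0r x); apply: F_pos.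
have [y yE] : exists y, y = a^-1 *: u by exists (a^-1 *: u).
have nFy : ~ F y.
  move=> [b b0 yb]; apply: nFu; exists (a * b); first by apply: mulr_ge0 => //; apply: ltW.
  by rewrite -scalerA yb yE scalerA mulfV ?gt_eqF// scale1r.
have yK : K y by rewrite yE; apply: KZ => //; rewrite invr_ge0 ltW.
have xyK : K (x - y).
  have -> : x - y = a^-1 *: w.
    have -> : w = a *: x - u by rewrite auw addrC addKr.
    by rewrite yE scalerBr scalerA mulVf ?gt_eqF// scale1r.
  by apply: KZ => //; rewrite invr_ge0 ltW.
have y0 : y != 0.
  by apply/eqP => y0; apply: nFy; rewrite y0 -(scale0r x); apply: F_pos.
have ty0 : forall i, (i < m)%N -> tc i y = 0.
  by apply: (tc_vanish_le yK xyK) => i; rewrite addrC subrK; apply: tx0.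
have [ym|ym] := eqVneq (tc m y) 0.
  exists y; split=> // i; rewrite leq_eqVlt => /orP[/eqP->//|]; exact: ty0.
have [||eps eps0 yeK] := @hcone_extend y (x - y) m yK xyK.
- by move=> i im; rewrite addrC subrK tx0.
- move=> i /andP[mi id_]; apply: (tc_gt0_up hyp (k := 0) (i := m) _ id_) => //.
    by move=> l _; apply: (KP _).1.
  by rewrite lt0r ym; apply: (KP _).1.
(* The point y - eps (x - y) of the cone, scaled so as to be y - c x. *)
pose c := eps / (1 + eps).
have c0 : 0 < c by rewrite divr_gt0// ltr_pwDl// ltW.
have ycK : K (y - c *: x).
  have -> : y - c *: x = (1 + eps)^-1 *: (y - eps *: (x - y)).
    have -> : y - eps *: (x - y) = (1 + eps) *: y - eps *: x.
      by rewrite scalerBr opprB scalerDl scale1r addrA.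
    have e1 : 1 + eps != 0 by rewrite gt_eqF// ltr_pwDl// ltW.
    by rewrite scalerBr !scalerA (mulVf e1) scale1r [_^-1 * _]mulrC.
  by apply: KZ => //; rewrite invr_ge0 addr_ge0// ltW.
have [||s [s0 ysK ys0]] := @hcone_exit y (c *: x) m yK _ ycK _ ty0.
- by apply: KZ => //; apply: ltW.
- by rewrite scaler_eq0 negb_or gt_eqF.
rewrite scalerA in ysK ys0.
have sc0 : 0 <= s * c by rewrite mulr_ge0// ltW.
exists (y - (s * c) *: x); split=> //.
- by rewrite opprB addrCA; apply: KD => //; apply: KZ.
- apply/eqP => /eqP; rewrite subr_eq0 => /eqP yscx.
  by apply: nFy; rewrite yscx; apply: F_pos.
- by move=> i im; apply: ys0 => //; apply: leq_trans md.
Qed.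

(** Induction on the multiplicity m of the zero of p at x along e. If x does not
    span an extreme ray, subtract from it as much as possible of a vector y below
    it of higher multiplicity; the difference has higher multiplicity too. *)
Lemma hcone_rank_le1_sum x : K x -> rank_le1_sum x.
Proof.
suff H j : forall m x, (d - m <= j)%N -> K x ->
    (forall i, (i < m)%N -> tc i x = 0) -> rank_le1_sum x.
  by move=> xK; apply: (H d 0%N) => //; rewrite subn0.
have zero : rank_le1_sum 0 by exists [::]; rewrite ?big_nil.
elim: j => [|j IH] m {}x dm xK x0.
  have -> // : x = 0.
  by apply: tc_all0 => i id_; apply: x0; apply: leq_trans id_ _; rewrite -subn_eq0 -leqn0.
have [->//|xn0] := eqVneq x 0.
have md : (m <= d)%N.
  rewrite leqNgt; apply/negP => dm'; case/eqP: xn0; apply: tc_all0 => i id_.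
  by apply: x0; apply: ltn_trans dm'.
have IH1 y : K y -> (forall i, (i <= m)%N -> tc i y = 0) -> rank_le1_sum y.
  by move=> yK y0; apply: (IH m.+1) => //; lia.
have [face|nface] :=
  pselect (cone_face K [set a *: x | a in [set a : R | 0 <= a]]).
  exact/rank_le1_sum1/rog_extreme.
have [y [yK xyK yn0 y0]] := not_extreme_below xK xn0 x0 md nface.
have [s [s0 xsK xs0]] := hcone_exit xK yK xyK yn0 x0.
rewrite -[x](subrK (s *: y)); apply: rank_le1_sumD.
  by apply: IH1 => // i im; apply: xs0 => //; apply: leq_trans md.
by apply: rank_le1_sumZ => //; apply: IH1.
Qed.

End Decomposition.

(** * Directional derivatives *)

Section Gradient.
Variables (R : realType) (n : nat) (q : mpoly n R).
Implicit Types (z v w : 'cV[R]_n).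

(** Both sides are coefficients of the polynomial q(z + s v + t w) in s and t,
    the left one after the substitution t = s. *)
Lemma line_coef1D z v w :
  (line_poly q z (v + w))`_1 = (line_poly q z v)`_1 + (line_poly q z w)`_1.
Proof.
pose B : {poly {poly R}} := mmap (fun c : R => (c%:P)%:P)
  (fun i => ((z i 0)%:P + v i 0 *: 'X)%:P + (w i 0)%:P *: 'X) q.
have diag : B.['X] = line_poly q z (v + w).
  rewrite -[LHS]/(horner_eval 'X B) rmorph_mmap; apply: mmap_ext => [c|i] /=.
    by rewrite /horner_eval hornerC.
  rewrite /horner_eval hornerD hornerC hornerZ hornerX !mxE scalerDl addrA.
  by rewrite mul_polyC.
have col0 : B`_0 = line_poly q z v.
  rewrite -horner_coef0 -[LHS]/(horner_eval 0 B) rmorph_mmap.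
  apply: mmap_ext => [c|i] /=; first by rewrite /horner_eval hornerC.
  by rewrite /horner_eval hornerD hornerC hornerZ hornerX mulr0 addr0.
have row0 : map_poly (horner_eval 0) B = line_poly q z w.
  rewrite rmorph_mmap; apply: mmap_ext => [c|i] /=.
    by rewrite map_polyC /= /horner_eval hornerC.
  rewrite rmorphD /= map_polyC linearZ /= map_polyX /horner_eval /=.
  by rewrite hornerD hornerZ !hornerC hornerX mulr0 addr0.
rewrite -diag -col0 -row0 coef_map /= /horner_eval.
have c0 (P : {poly {poly R}}) : (P.['X])`_0 = (P`_0).[0].
  elim/poly_ind: P => [|P c _]; first by rewrite horner0 !coef0 horner0.
  by rewrite hornerMXaddC !coefD !coefMX !coefC /= !add0r horner_coef0.
elim/poly_ind: B {diag col0 row0} => [|P c _].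
  by rewrite horner0 !coef0 horner0 addr0.
by rewrite hornerMXaddC !coefD !coefMX !coefC /= add0r addr0 c0 addrC.
Qed.

Lemma line_coef1Z z v a :
  (line_poly q z (a *: v))`_1 = a * (line_poly q z v)`_1.
Proof.
have -> : line_poly q z (a *: v) = line_poly q z v \Po (a *: 'X).
  apply: poly_ext => s _; rewrite horner_comp !line_polyE hornerZ hornerX.
  by rewrite scalerA mulrC.
by rewrite coef_comp_scaleX expr1.
Qed.

End Gradient.

(** * Automorphisms of the derivative cones *)

Section Automorphisms.
Variables (R : realType) (n d : nat) (p : mpoly n R) (e : 'cV[R]_n).
Hypothesis hyp : hyperbolic d p e.
Hypothesis K_pointed : pointed (hcone p e).
Implicit Types (x y z v w : 'cV[R]_n).
Local Notation tc := (taylor p e).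
Local Notation K := (hcone p e).

Let hom_p : mhomogeneous d p. Proof. by have [] := hyp. Qed.
Let KP x : K x <-> forall i, 0 <= tc i x. Proof. exact: hconeP hyp x. Qed.

Lemma tc_affine x j b t : affine_along p x ->
  tc j (b + t *: x) = tc j b + t * (tc j (b + x) - tc j b).
Proof.
move=> xa; suff E : line_poly p (b + t *: x) e =
    line_poly p b e + t *: (line_poly p (b + x) e - line_poly p b e).
  by rewrite /taylor E coefD coefZ coefB.
apply: poly_ext => s _; rewrite hornerD hornerZ hornerD hornerN !line_polyE.
by rewrite addrAC xa [b + x + _]addrAC.
Qed.

Lemma tc_at0 i : (i < d)%N -> tc i 0 = 0.
Proof.
move=> id_; have := tc_homogV hyp 0 (a := 2) _ (ltnW id_).
rewrite scaler0 => /(_ (lt0r_neq0 (ltr0n _ 2))) /eqP.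
rewrite -[X in X == _]mul1r -subr_eq0 -mulrBl mulf_eq0 subr_eq0 => /orP[|/eqP//].
by rewrite eq_sym -natrX pnatr_eq1; case: (d - i)%N (subn_gt0 i d) => [|m];
  rewrite id_// expnS; lia.
Qed.

Lemma line_poly_rank_le1 x : (0 < d)%N -> affine_along p x ->
  line_poly p x e = peval p e *: 'X^d + (peval p (e + x) - peval p e) *: 'X^(d.-1).
Proof.
move=> d0 xa; apply: poly_ext => s s0.
rewrite line_polyE !(hornerD, hornerZ, hornerXn).
have -> : x + s *: e = s *: (e + s^-1 *: x).
  by rewrite scalerDr scalerA mulfV ?gt_eqF// scale1r addrC.
rewrite (peval_homog hom_p) xa mulrDr [_ * s ^+ d]mulrC; congr (_ + _).
rewrite -[in LHS](prednK d0) exprS mulrA [s * _ * _]mulrAC mulfV ?gt_eqF//.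
by rewrite mul1r mulrC.
Qed.

(** The increment is the coefficient c_(d-1)(x); if it vanished, all c_i(x) with
    i < d would vanish and x would be 0. *)
Lemma rank_le1_increment x : (0 < d)%N -> K x -> affine_along p x -> x != 0 ->
  0 < peval p (e + x) - peval p e.
Proof.
move=> d0 xK xa x0; have lx := line_poly_rank_le1 d0 xa.
set b := _ - _ in lx *.
have bE : tc d.-1 x = b.
  rewrite /taylor lx coefD !coefZ !coefXn eqxx ltn_eqF ?prednK//.
  by rewrite mulr0 add0r mulr1.
rewrite -bE lt0r ((KP x).1 xK) andbT; apply: contra x0 => /eqP b0.
apply/eqP/(tc_all0 hyp K_pointed) => i id_.
rewrite /taylor lx -bE b0 scale0r addr0 coefZ coefXn ltn_eqF//.
by rewrite mulr0.
Qed.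

Lemma tc_line_e i x : tc_line p e i x e = (i`!%:R)^-1 *: (line_poly p x e)^`(i).
Proof. by rewrite /tc_line line_poly_dirderiv. Qed.

(** Both increments are read off from p(x + t e) = a t^d + b t^(d-1), where
    a = p(e) and b = p(e + x) - p(e). *)
Lemma tc_increment x j : (j < d)%N -> K x -> affine_along p x -> x != 0 ->
  0 < tc j (e + x) - tc j e.
Proof.
move=> jd xK xa x0; have d0 : (0 < d)%N by apply: leq_ltn_trans jd.
have b0 := rank_le1_increment d0 xK xa x0.
have lx := line_poly_rank_le1 d0 xa.
have l0 : line_poly p 0 e = peval p e *: 'X^d.
  rewrite (line_poly_rank_le1 d0); last first.
    by move=> b t; rewrite scaler0 !addr0 subrr mulr0 addr0.
  by rewrite addr0 subrr scale0r addr0.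
set b := _ - _ in b0 lx.
have E y : tc j (e + y) = (j`!%:R)^-1 * (line_poly p y e)^`(j).[1].
  by rewrite addrC -[e in y + e]scale1r -horner_tc_line tc_line_e hornerZ.
rewrite E -[e in tc j e]addr0 E lx l0 -mulrBr derivnD hornerD [X in X - _]addrC addrK.
rewrite mulr_gt0// ?invr_gt0 ?ltr0n ?fact_gt0//.
rewrite derivnZ hornerZ derivnXn hornerMn hornerXn expr1n mulr_gt0// ltr0n.
by rewrite ffact_gt0; move: jd; case: (d) => // d' ; rewrite ltnS.
Qed.

Variable k : nat.
Hypothesis k_le : (k <= d - 3)%N.
Hypothesis d_ge3 : (3 < d)%N.

Local Notation Kk := (derivative_cone k p e).

Let kd : (k <= d)%N. Proof. by move: k_le d_ge3; lia. Qed.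
Let KkP x : Kk x <-> forall i, (k <= i)%N -> 0 <= tc i x.
Proof. exact (derivative_coneP hyp x kd). Qed.

(** At a point z where D^(k+1) p does not vanish, c_k >= 0 is the only constraint
    that can be active, and its gradient is not zero: up to first order, the cone
    is a half space at z unless z is an interior point. *)
Lemma smooth_feasible z v : Kk z -> 0 < tc k.+1 z ->
  0 < (tc_line p e k z v)`_1 ->
  exists2 del : R, 0 < del & forall s, 0 < s -> s < del -> Kk (z + s *: v).
Proof.
move=> /KkP zK z1 v1.
have up i : (k.+1 <= i <= d)%N -> 0 < tc i z.
  move=> /andP[ki id_]; apply: (tc_gt0_up hyp (k := k) _ id_ zK z1).
  by rewrite leqnSn.
have [del del0 h] := tc_gt0_near_line v up.
have gE : exists g, tc_line p e k z v = (tc k z)%:P + g * 'X.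
  have g0 : (tc_line p e k z v - (tc k z)%:P).[0] = 0.
    by rewrite hornerD hornerN hornerC horner_tc_line scale0r addr0 subrr.
  exists ((tc_line p e k z v - (tc k z)%:P) %/ 'X); rewrite divpK; last first.
    by rewrite -['X]subr0 dvdp_XsubCl rootE g0.
  by rewrite addrC subrK.
have [g {}gE] := gE.
have [|del' del'0 h'] := @horner_gt0_near0 _ g.
  by rewrite horner_coef0; move: v1; rewrite gE coefD coefC coefMX add0r.
exists (Num.min del del'); first by rewrite lt_min del0.
move=> s s0; rewrite lt_min => /andP[sd sd']; apply/KkP => i.
rewrite leq_eqVlt => /orP[/eqP<-|ki].
  rewrite -horner_tc_line gE hornerD hornerC hornerM hornerX.
  rewrite addr_ge0 ?zK// mulr_ge0// ltW// h'//.
  by rewrite gtr0_norm.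
have [id_|di] := leqP i d; last by rewrite (tc_gt_d hyp).
by rewrite ltW// h ?gtr0_norm// ki.
Qed.

(** At x + s w, the cubic form D^(d-3) p is the sum of s^2 times its derivative at
    w in the direction x and of s^3 times its value at w. *)
Lemma feasible_increment x w (del : R) : affine_along p x -> 0 < del ->
  (forall s, 0 < s -> s < del -> Kk (x + s *: w)) ->
  0 <= tc (d - 3) (w + x) - tc (d - 3) w.
Proof.
move=> xa del0 feas; set Q := _ - _.
have : 0 <= ((tc (d - 3) w)%:P * 'X + Q%:P).[0].
  apply: (horner0_ge0 del0) => s s0 sd; rewrite hornerMXaddC hornerC.
  have d3 : (d - (d - 3) = 3)%N by rewrite subKn// ltnW.
  have d3' : (d - 3 <= d)%N by rewrite leq_subr.
  have /KkP/(_ _ k_le) := feas s s0 sd.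
  have -> : x + s *: w = s *: (w + s^-1 *: x).
    by rewrite scalerDr scalerA mulfV ?gt_eqF// scale1r addrC.
  rewrite (tc_homogV hyp _ (lt0r_neq0 s0) d3') d3 pmulr_rge0 ?exprn_gt0//.
  rewrite tc_affine// -/Q => H; rewrite -(pmulr_lge0 _ s0) in H.
  by move: H; rewrite mulrDl mulrAC mulVf ?gt_eqF// mul1r.
by rewrite hornerMXaddC mulr0 add0r.
Qed.

Lemma increment_homog x w a : affine_along p x -> a != 0 ->
  tc (d - 3) (a *: w + x) - tc (d - 3) (a *: w) =
  a ^+ 2 * (tc (d - 3) (w + x) - tc (d - 3) w).
Proof.
move=> xa a0.
have d3 : (d - (d - 3) = 3)%N by rewrite subKn// ltnW.
have d3' : (d - 3 <= d)%N by rewrite leq_subr.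
have -> : a *: w + x = a *: (w + a^-1 *: x).
  by rewrite scalerDr scalerA mulfV// scale1r.
rewrite !(tc_homogV hyp _ a0 d3') d3 tc_affine//; field.
by [].
Qed.

(** If x were a smooth point, the quadratic form Q given by the derivative of
    D^(d-3) p in the direction x would be nonnegative on a half space, hence
    everywhere as it is even. It is affine along vectors of rank at most one, so
    it would not change along them; as e is a sum of such vectors, Q(e) would
    equal Q(0) = 0, whereas Q(e) > 0. *)
Lemma rank_le1_not_smooth x w0 (l : 'cV[R]_n -> R) : rank_le1_sum p e e ->
  K x -> affine_along p x -> x != 0 ->
  (forall v w, l (v + w) = l v + l w) -> (forall a v, l (a *: v) = a * l v) ->
  0 < l w0 ->
  ~ (forall w, 0 < l w ->
       exists2 del : R, 0 < del & forall s, 0 < s -> s < del -> Kk (x + s *: w)).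
Proof.
move=> [xs xs_r eE] xK xa x0 lD lZ l0 smooth.
pose Q w := tc (d - 3) (w + x) - tc (d - 3) w.
have Qpos w : 0 < l w -> 0 <= Q w.
  by move=> /smooth[del del0 feas]; apply: feasible_increment feas.
have Qge w : 0 <= l w -> 0 <= Q w.
  move=> lw; pose g := tc_line p e (d - 3) (w + x) w0 - tc_line p e (d - 3) w w0.
  have gE s : g.[s] = Q (w + s *: w0).
    by rewrite hornerD hornerN !horner_tc_line /Q addrAC.
  have -> : Q w = g.[0] by rewrite gE scale0r addr0.
  apply: (horner0_ge0 ltr01) => s s0 _; rewrite gE; apply: Qpos.
  by rewrite lD lZ ltr_wpDl// mulr_gt0.
have Q0 w : 0 <= Q w.
  have [lw|lw] := leP 0 (l w); first exact: Qge.
  have /Qge : 0 <= l (-1 *: w) by rewrite lZ mulN1r oppr_ge0 ltW.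
  by rewrite /Q increment_homog ?oppr_eq0 ?oner_neq0// sqrrN expr1n mul1r.
have Q_invariant y b : rank_le1 p e y -> Q (b + y) = Q b.
  move=> [_ ya].
  have line t : Q (b + t *: y) = Q b + t * (Q (b + y) - Q b).
    by rewrite /Q addrAC !tc_affine// [b + x + y]addrAC; ring.
  apply/eqP; rewrite -subr_eq0; set D := Q (b + y) - Q b in line *.
  apply: contraT => D0; have := Q0 (b + ((- Q b - 1) / D) *: y).
  by rewrite line divfK//; lra.
have Qe : Q e = Q 0.
  rewrite eE; elim: (xs) xs_r => [|y s IH] sr; first by rewrite big_nil.
  rewrite big_cons addrC Q_invariant; last by apply: sr; rewrite mem_head.
  by apply: IH => z zs; apply: sr; rewrite inE zs orbT.
have Q00 : Q 0 = 0.
  have := @increment_homog x 0 2 xa (lt0r_neq0 (ltr0n _ 2)).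
  by rewrite scaler0 -/(Q 0); lra.
have jd : (d - 3 < d)%N by lia.
have := tc_increment jd xK xa x0.
by rewrite -/(Q e) Qe Q00 ltxx.
Qed.

(** If A x were not in the cone then D^(k+1) p would not vanish there, so that A x
    would be a smooth point of the derivative cone, and so would x since A is a
    linear automorphism of that cone. *)
Lemma cone_aut_rank_le1 A x : rank_le1_sum p e e -> cone_aut Kk A ->
  rank_le1 p e x -> K (A *m x).
Proof.
move=> e_sum [A_unit AK] [xK xa].
have [->|x0] := eqVneq x 0; first by rewrite mulmx0; apply: hcone0 hyp.
set z := A *m x.
have zK : Kk z by rewrite -AK; exists x => //; apply: (hcone_derivative hyp).
have [z1|z1] := eqVneq (tc k.+1 z) 0.
  by apply: (derivative_cone_mult2 hyp _ _ z1); [move: k_le d_ge3; lia | exact/KkP].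
have {}z1 : 0 < tc k.+1 z by rewrite lt0r z1; move/KkP: zK => ->.
pose l v := (tc_line p e k z (A *m v))`_1.
case: (@rank_le1_not_smooth x (invmx A *m e) l e_sum xK xa x0).
- by move=> v w; rewrite /l mulmxDr /tc_line !coefZ line_coef1D mulrDr.
- by move=> a v; rewrite /l -scalemxAr /tc_line !coefZ line_coef1Z mulrCA.
- rewrite /l mulKVmx// tc_line_e coefZ mulr_gt0 ?invr_gt0 ?ltr0n ?fact_gt0//.
  by rewrite coef_derivn addn1 pmulrn_lgt0 ?ffact_gt0.
- move=> w /(smooth_feasible zK z1)[del del0 feas]; exists del => // s s0 sd.
  have := feas s s0 sd; rewrite /z scalemxAr -mulmxDr -[in X in X -> _]AK.
  by move=> [y yK /(can_inj (mulKmx A_unit)) <-].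
Qed.

End Automorphisms.

(** * The derivative cone is strictly larger *)

Section Strict.
Variables (R : realType) (n d : nat) (p : mpoly n R) (e : 'cV[R]_n).
Hypothesis hyp : hyperbolic d p e.
Hypothesis d_gt0 : (0 < d)%N.
Local Notation tc := (taylor p e).
Local Notation K := (hcone p e).

Let hom_p : mhomogeneous d p. Proof. by have [] := hyp. Qed.
Let KP x : K x <-> forall i, 0 <= tc i x. Proof. exact: hconeP hyp x. Qed.

(** Adding a vector y of rank at most one to a boundary point z lowers the
    multiplicity by at most one: with y <= e / c, p(z + c t y) = c t p(z + y) is at
    most p(z + t e), so it vanishes if p(z + t e) is of order t^2. *)
Lemma rank_step z y : K z -> rank_le1 p e y -> peval p z = 0 ->
  0 < peval p (z + y) -> 0 < tc 1 z.
Proof.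
move=> zK [yK ya] z0 zy; rewrite lt0r ((KP z).1 zK) andbT; apply/eqP => z1.
have [del del0 near] := int_cone_near_line hyp (- y) (int_cone_e hyp).
pose c := del / 2; have c0 : 0 < c by rewrite divr_gt0.
have eyK : K (e - c *: y).
  apply: (int_hcone hyp); rewrite -scalerN; apply: near.
  by rewrite gtr0_norm// /c; lra.
suff /eqP : ((c * peval p (z + y)) *: 'X : {poly R})`_1 = 0.
  by rewrite coefZ coefX mulr1 mulf_eq0 !gt_eqF.
apply: (@coef_dominated _ _ (line_poly p z e) 1 2 ltr01) => [i|s s0 _|i|] //.
- by rewrite coefZ coefX mulr_ge0 ?ler0n// ltW// mulr_gt0.
- rewrite hornerZ hornerX line_polyE.
  have -> : c * peval p (z + y) * s = peval p (z + (s * c) *: y).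
    by rewrite ya z0; ring.
  have -> : z + s *: e = z + (s * c) *: y + s *: (e - c *: y).
    by rewrite scalerBr scalerA addrA addrAC addrK.
  apply: (peval_mono hyp).
    by apply: (hconeD hyp) => //; apply: (hconeZ hyp) => //; rewrite mulr_ge0// ltW.
  by apply: (hconeZ hyp) => //; apply: ltW.
- by case: i => [|[|]]// _; rewrite -[LHS]/(tc 0 z) tc0.
Qed.

(** The partial sums of a decomposition of e pass from the boundary to the
    interior, hence through a boundary point of multiplicity 1. *)
Lemma exists_mult1 : rank_le1_sum p e e ->
  exists z, [/\ K z, peval p z = 0 & 0 < tc 1 z].
Proof.
move=> [xs xs_r eE].
have : 0 < peval p (\sum_(y <- xs) y) by rewrite -eE; have [] := hyp.
elim: xs xs_r {eE} => [|y s IH] sr.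
  by rewrite big_nil -(tc0 p e) (tc_at0 hyp d_gt0) ltxx.
have sr' z : z \in s -> rank_le1 p e z.
  by move=> zs; apply: sr; rewrite inE zs orbT.
rewrite big_cons addrC => py.
have sK : K (\sum_(j <- s) j) by apply: (hcone_sum hyp) => z /sr'[].
have [s0|s0] := eqVneq (peval p (\sum_(j <- s) j)) 0; last first.
  by apply: IH => //; rewrite lt0r s0 (peval_ge0 hyp).
exists (\sum_(j <- s) j); split=> //; apply: rank_step py => //.
by apply: sr; rewrite mem_head.
Qed.

(** At a boundary point z of multiplicity 1, all c_i(z) with i > 0 are positive,
    so that z is in the interior of the derivative cone, and so is z - s e for
    small s > 0. *)
Lemma derivative_cone_larger k : (0 < k <= d)%N -> rank_le1_sum p e e ->
  exists2 y, relint (derivative_cone k p e) y & ~ K y.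
Proof.
move=> /andP[k0 kd] /exists_mult1[z [zK z0 z1]].
have zpos i : (k <= i <= d)%N -> 0 < tc i z.
  move=> /andP[ki id_]; apply: (tc_gt0_up hyp (k := 0) _ id_ _ z1).
    by rewrite (leq_trans k0).
  by move=> l _; apply: (KP z).1.
have [del del0 near] := tc_gt0_near_line (- e) zpos.
have h0 : 0 < del / 2 by rewrite divr_gt0.
exists (z + (del / 2) *: - e).
  apply: (relint_derivative_cone hyp kd) => i; apply: near.
  by rewrite gtr0_norm//; lra.
move=> /(hcone_int hyp) /(_ h0) /(_ 0 (lexx 0)).
by rewrite scale0r addr0 scalerN subrK z0 ltxx.
Qed.

End Strict.

(** * Non-homogeneity *)

Theorem corollary4p7 (R : realType) (n d : nat) (p : mpoly n R)
    (e : 'cV[R]_n) (k : nat) :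
  hyperbolic d p e ->
  regular_cone (hcone p e) ->
  rank_one_generated p e ->
  (1 <= k <= d - 3)%N ->
  ~ homogeneous_cone (derivative_cone k p e).
Proof.
move=> hyp _ rog /andP[k1 kd3] homog.
have d3 : (3 < d)%N by lia.
have d0 : (0 < d)%N by lia.
have kd : (k <= d)%N by lia.
have K_pointed := rog.1.
have e_sum : rank_le1_sum p e e.
  apply: (hcone_rank_le1_sum hyp d0 K_pointed rog).
  exact: (int_hcone hyp (int_cone_e hyp)).
have [|y yint yK] := derivative_cone_larger hyp d0 (k := k) _ e_sum.
  by rewrite k1 kd.
have eint : relint (derivative_cone k p e) e.
  apply: (relint_derivative_cone hyp kd) => i /andP[_ id_].
  by have /(int_coneP hyp) := int_cone_e hyp; apply.
have [A Aaut Ae] := homog e y eint yint.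
apply: yK; rewrite -Ae; have [xs xs_r eE] := e_sum.
rewrite [X in A *m X]eE mulmx_sumr; apply: (hcone_sum hyp) => x /xs_r.
exact: (cone_aut_rank_le1 hyp K_pointed kd3 d3 e_sum Aaut).
Qed.
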